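(* Let $n\ge2$, let $\Omega\subset\mathbb{R}^n$ be a bounded open set, let $U_0\subset\subset\Omega$ be open, let $x_0\in\partial U_0$, and let $A_k=I$ (the identity matrix) for every $k$. Let $f_k$ be the sequence in $L^\infty(\Omega)$ constructed, together with $r_k$, $R_k$, $x_k$, as described in the context. Then for every strictly increasing function $\sigma\colon\mathbb{N}\to\mathbb{N}$ there exists an open set $U\subset\Omega$ such that $\nu'_\sigma(U)\ne\nu''_\sigma(U)$. In particular, the sequence $F_{\sigma(k)}(\cdot,U)$ does not $\Gamma$-converge in the weak topology of $H^1_0(U)$.
   Context: $V\subset\subset U$ means that $\overline V$ is compact and contained in $U$; $B(x,r)$ is the open ball with center $x$ and radius $r$; $\chi_E$ is the characteristic function of $E$. For $U$ bounded open, $H^1_0(U)$ is normed by $\|u\|_{H^1_0(U)}=(\int_U|\nabla u|^2dx)^{1/2}$ and $H^{-1}(U)$ is its dual, with the dual norm; a bounded function $f$ is identified with the functional $v\mapsto\int_U fv\,dx$. Functions in $H^1_0(U)$, $U\subset\Omega$ open, are extended by $0$ to $\Omega$. Construction of $f_k$. Fix $R>0$ with $B(x_0,2R)\subset\subset\Omega$ and a sequence $0<r_k<R$ converging to $0$. Set $g_k=c_k\chi_{B(0,r_k)}$ with $c_k=\sqrt2/\|\chi_{B(0,r_k)}\|_{H^{-1}(B(0,2R))}$, so that $\|g_k\|^2_{H^{-1}(B(0,2R))}=2$. Let $u_{g_k}\in H^1_0(B(0,2R))$ be the solution of $-\Delta u_{g_k}=g_k$ in $B(0,2R)$, and set $$R_k=r_k+\frac1k+\Big(\int_{B(0,2R)}u_{g_k}^2\,dx\Big)^{1/4}.$$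 Then $R_k\to0$ and $r_k<R_k<R$ for $k$ large enough. Fix a sequence $x_k\in U_0$ converging to $x_0$ such that $B(x_k,R_k)\subset\subset U_0$ for $k$ large enough, and set $f_k(x)=g_k(x-x_k)$ for $x\in\Omega$. Functionals and set functions. For $U\subset\Omega$ open and $v\in H^1_0(U)$ let $$F_k(v,U)=\frac12\int_U|\nabla v|^2dx-\int_Uf_kv\,dx .$$ For a strictly increasing $\sigma\colon\mathbb{N}\to\mathbb{N}$ define $$-\nu'_\sigma(U)=\inf_{v_k\in H^1_0(U),\,v_k\rightharpoonup0}\ \liminf_{k\to\infty}F_{\sigma(k)}(v_k,U),\qquad -\nu''_\sigma(U)=\inf_{v_k\in H^1_0(U),\,v_k\rightharpoonup0}\ \limsup_{k\to\infty}F_{\sigma(k)}(v_k,U),$$ where the infima are over sequences converging to $0$ weakly in $H^1_0(U)$. $\Gamma$-convergence in the weak topology of $H^1_0(U)$ of a sequence $G_k$ of functionals on $H^1_0(U)$: the $\Gamma$-$\liminf$ and $\Gamma$-$\limsup$ at $v$ are $\sup_N\liminf_k\inf_{w\in N}G_k(w)$ and $\sup_N\limsup_k\inf_{w\in N}G_k(w)$, with $N$ ranging over weak neighbourhoods of $v$; $G_k$ $\Gamma$-converges if they coincide for every $v$. For the equi-coercive functionals considered here, these quantities are equivalently the infima of $\liminf_kG_k(v_k)$ and of $\limsup_kG_k(v_k)$ over all sequences $v_k\rightharpoonup v$ weakly in $H^1_0(U)$. *)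

(* Defs.v *)
From HB Require Import structures.
From mathcomp Require Import all_boot all_order all_algebra.
From mathcomp Require Import all_classical all_reals all_analysis.

Set Implicit Arguments.
Unset Strict Implicit.
Unset Printing Implicit Defensive.

Import Order.TTheory GRing.Theory Num.Theory.
Import numFieldNormedType.Exports.

Local Open Scope classical_set_scope.
Local Open Scope ring_scope.

(* R^n is 'rV[R]_n. The norm provided by the library on 'rV[R]_n is the
   maximum norm; it is only used for the topology. Balls and lengths of
   gradients are Euclidean. *)

Section euclidean.
Context {R : realType} {n : nat}.
Implicit Types (x y : 'rV[R]_n) (U V : set 'rV[R]_n).

Definition edot x y : R := \sum_(i < n) x 0 i * y 0 i.

Definition enorm x : R := Num.sqrt (edot x x).

Definition eball x (r : R) : set 'rV[R]_n := [set y | enorm (y - x) < r].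

Definition compactly_contained V U := compact (closure V) /\ closure V `<=` U.

Definition boundary U : set 'rV[R]_n := closure U `\` interior U.

End euclidean.

(* The sigma-algebra on 'rV[R]_n generated by the coordinates (it coincides
   with the Borel sigma-algebra). *)

Section measurable_rV.
Context {R : realType}.
Variable n : nat.

Let coords : 'I_n -> 'rV[R]_n -> R := fun i x => x 0 i.

Let rV_set0 : g_sigma_preimage coords set0.
Proof. exact: sigma_algebra0. Qed.

Let rV_setC A : g_sigma_preimage coords A -> g_sigma_preimage coords (~` A).
Proof. exact: sigma_algebraC. Qed.

Let rV_bigcup (F : _^nat) : (forall i, g_sigma_preimage coords (F i)) ->
  g_sigma_preimage coords (\bigcup_i (F i)).
Proof. exact: sigma_algebra_bigcup. Qed.

HB.instance Definition _ := @isMeasurable.Build default_measure_display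
  'rV[R]_n (g_sigma_preimage coords) rV_set0 rV_setC rV_bigcup.

Lemma measurable_coord (i : 'I_n) :
  measurable_fun [set: 'rV[R]_n] (fun x : 'rV[R]_n => x 0 i).
Proof.
move=> _ Y mY; rewrite setTI; apply: sub_sigma_algebra => /=.
rewrite -bigcup_seq/=; exists i => /=; first by rewrite mem_index_enum.
by exists Y => //; rewrite setTI.
Qed.

Lemma measurable_fun_coord d (T : measurableType d) (f : T -> 'rV[R]_n) :
  (forall i, measurable_fun [set: T] (fun t => f t 0 i)) ->
  measurable_fun [set: T] f.
Proof.
move=> mf; suff H : (measurable : set (set 'rV[R]_n)) `<=`
    [set A | measurable (f @^-1` A)].
  by move=> _ A mA; rewrite setTI; exact: H.
apply: smallest_sub.
  split => /=.
  - by rewrite preimage_set0.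
  - by move=> A mA; rewrite setTD preimage_setC; exact: measurableC.
  - by move=> F mF; rewrite preimage_bigcup; exact: bigcupT_measurable.
rewrite -bigcup_seq => A [i _] [B mB <-] /=.
by rewrite setTI -[X in measurable X]setTI; exact: mf.
Qed.

End measurable_rV.

(* Lebesgue measure on R^n, as the n-fold product of the Lebesgue measure on
   the line: R^(n+1) is identified with R * R^n. *)

Section lebesgue_step.
Local Open Scope ereal_scope.
Context {R : realType} {n : nat}.
Variable m : {sigma_finite_measure set 'rV[R]_n -> \bar R}.

Definition cons_rV (p : R * 'rV[R]_n) : 'rV[R]_n.+1 :=
  \row_i oapp (p.2 0%R) p.1 (unlift ord0 i).

Let uncons_rV (v : 'rV[R]_n.+1) : R * 'rV[R]_n :=
  (v 0%R ord0, (\row_j v 0%R (lift ord0 j))%R).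

Let cons_rVK : cancel cons_rV uncons_rV.
Proof.
move=> [a v]; rewrite /uncons_rV /cons_rV; congr pair; first by rewrite mxE unlift_none.
by apply/rowP => j; rewrite !mxE liftK.
Qed.

Lemma measurable_cons_rV : measurable_fun setT cons_rV.
Proof.
apply: measurable_fun_coord => i.
under eq_fun do rewrite mxE.
case: unliftP => [j _|_] /=; last exact: measurable_fst.
exact: (measurableT_comp (measurable_coord j) measurable_snd).
Qed.

Let measurable_uncons_rV : measurable_fun setT uncons_rV.
Proof.
apply: measurable_fun_pair => /=; first exact: measurable_coord.
apply: measurable_fun_coord => i.
by under eq_fun do rewrite mxE; exact: measurable_coord.
Qed.

Definition lebesgue_step : set 'rV[R]_n.+1 -> \bar R :=
  pushforward (lebesgue_measure \x m) cons_rV.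

Let step0 : lebesgue_step set0 = 0.
Proof. by rewrite /lebesgue_step /pushforward preimage_set0 measure0. Qed.

Let step_ge0 A : 0 <= lebesgue_step A.
Proof. by rewrite /lebesgue_step /pushforward measure_ge0. Qed.

Let step_sigma_additive : semi_sigma_additive lebesgue_step.
Proof.
move=> F mF tF mUF; rewrite /lebesgue_step /pushforward preimage_bigcup.
apply: measure_semi_sigma_additive.
- by move=> k; rewrite -[X in measurable X]setTI; exact: measurable_cons_rV.
- apply/trivIsetP => /= i j _ _ ij; rewrite -preimage_setI.
  by move/trivIsetP : tF => /(_ _ _ _ _ ij) ->//; rewrite preimage_set0.
- by rewrite -preimage_bigcup -[X in measurable X]setTI; exact: measurable_cons_rV.
Qed.

HB.instance Definition _ := isMeasure.Build _ _ _ lebesgue_step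
  step0 step_ge0 step_sigma_additive.

Let step_sigma_finite : sigma_finite setT lebesgue_step.
Proof.
have /sigma_finiteP[F [TF ndF Foo]] :=
  @sigma_finiteT _ _ _ (lebesgue_measure : {sigma_finite_measure set _ -> \bar R}).
have /sigma_finiteP[G [TG ndG Goo]] := sigma_finiteT m.
exists (fun k => uncons_rV @^-1` (F k `*` G k)).
  rewrite -preimage_bigcup -[LHS](preimage_setT uncons_rV); congr (_ @^-1` _).
  rewrite -setXTT TF TG predeqE => -[x y]; split; last first.
    by move=> [k _ []/= ? ?]; split; exists k.
  move=> [/= [k _ Fkx] [l _ Gly]]; exists (maxn k l) => //; split.
  - by move: x Fkx; exact/subsetPset/ndF/leq_maxl.
  - by move: y Gly; exact/subsetPset/ndG/leq_maxr.
move=> k; have [mF Fk] := Foo k; have [mG Gk] := Goo k; split.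
  rewrite -[X in measurable X]setTI; apply: measurable_uncons_rV => //.
  exact: measurableX.
rewrite /lebesgue_step /pushforward -comp_preimage.
rewrite (_ : uncons_rV \o cons_rV = id) ?preimage_id; last exact/funext/cons_rVK.
by rewrite product_measure1E// lte_mul_pinfty// ge0_fin_numE.
Qed.

HB.instance Definition _ := Measure_isSigmaFinite.Build _ _ _ lebesgue_step
  step_sigma_finite.

End lebesgue_step.

Fixpoint lebesgue_rV (R : realType) (n : nat) :
    {sigma_finite_measure set 'rV[R]_n -> \bar R} :=
  match n with
  | 0 => \d_(0%R : 'rV[R]_0)
  | k.+1 => lebesgue_step (lebesgue_rV R k)
  end.

Section sobolev.
Context {R : realType} {n : nat}.
Notation Rn := 'rV[R]_n.
Notation mu := (lebesgue_rV R n).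
Implicit Types (U : set Rn) (f u v w phi : Rn -> R) (G : Rn -> Rn).

Definition partial (i : 'I_n) f : Rn -> R := fun y => 'D_(delta_mx 0 i) f y.

Definition smooth f := forall s : seq 'I_n,
  continuous (foldr partial f s) /\
  forall (i : 'I_n) y, derivable (foldr partial f s) y (delta_mx 0 i).

Definition test_function U phi :=
  [/\ smooth phi, compact (closure [set y | phi y != 0]) &
      closure [set y | phi y != 0] `<=` U].

Definition grad f : Rn -> Rn := fun y => \row_i partial i f y.

Definition L2 U f := measurable_fun U f /\
  (\int[mu]_(y in U) ((f y) ^+ 2)%:E < +oo)%E.

Definition weak_gradient U v G :=
  forall phi, test_function U phi -> forall i : 'I_n,
    \int[mu]_(y in U) (v y * partial i phi y) =
    - \int[mu]_(y in U) (G y 0 i * phi y).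

(* v belongs to H^1(U), with weak gradient G, and is a limit of test functions
   in the norm of H^1(U); such a G is unique a.e. in U. The functions are
   defined on the whole of R^n but only their values in U are relevant. *)
Definition H10_gradient U v G :=
  [/\ L2 U v, forall i : 'I_n, L2 U (fun y => G y 0 i), weak_gradient U v G &
   exists phi_ : nat -> Rn -> R,
    [/\ forall j, test_function U (phi_ j),
        \int[mu]_(y in U) ((phi_ j y - v y) ^+ 2) @[j --> \oo] --> (0 : R) &
        \int[mu]_(y in U) edot (grad (phi_ j) y - G y) (grad (phi_ j) y - G y)
          @[j --> \oo] --> (0 : R)]].

Definition H10 U : set (Rn -> R) := [set v | exists G, H10_gradient U v G].

Definition wgrad U v : Rn -> Rn := get (H10_gradient U v).

Definition H10_norm U v : R :=
  Num.sqrt (\int[mu]_(y in U) edot (wgrad U v y) (wgrad U v y)).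

(* Elements of H^{-1}(U); l is only relevant on H^1_0(U). A functional that is
   linear and bounded does not distinguish functions equal a.e. in U. *)
Definition Hm1 U (l : (Rn -> R) -> R) :=
  (forall (a : R) v w, H10 U v -> H10 U w ->
     l (fun y => a * v y + w y) = a * l v + l w) /\
  exists C : R, forall v, H10 U v -> `|l v| <= C * H10_norm U v.

Definition Hm1_norm U (l : (Rn -> R) -> R) : R :=
  sup [set `|l v| | v in [set v | H10 U v /\ H10_norm U v <= 1]].

Definition functional_of U f : (Rn -> R) -> R :=
  fun v => \int[mu]_(y in U) (f y * v y).

Definition weak_cvg U (v_ : nat -> Rn -> R) v :=
  forall l, Hm1 U l -> l (v_ k) @[k --> \oo] --> l v.

Definition weak_nbhs U v (N : set (Rn -> R)) :=
  N `<=` H10 U /\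
  exists (m : nat) (l : 'I_m -> (Rn -> R) -> R) (e : R),
    [/\ forall i, Hm1 U (l i), 0 < e &
        [set w | H10 U w /\ forall i, `|l i w - l i v| < e] `<=` N].

Definition Gamma_liminf U (G : nat -> (Rn -> R) -> R) v : \bar R :=
  ereal_sup [set limn_einf (fun k => ereal_inf [set (G k w)%:E | w in N])
            | N in weak_nbhs U v].

Definition Gamma_limsup U (G : nat -> (Rn -> R) -> R) v : \bar R :=
  ereal_sup [set limn_esup (fun k => ereal_inf [set (G k w)%:E | w in N])
            | N in weak_nbhs U v].

Definition Gamma_converges U (G : nat -> (Rn -> R) -> R) :=
  forall v, H10 U v -> Gamma_liminf U G v = Gamma_limsup U G v.

Definition poisson_solution U f u :=
  H10 U u /\ forall v, H10 U v ->
    \int[mu]_(y in U) edot (wgrad U u y) (wgrad U v y) =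
    \int[mu]_(y in U) (f y * v y).

Definition energy f v U : R :=
  2^-1 * (\int[mu]_(y in U) edot (wgrad U v y) (wgrad U v y))
  - \int[mu]_(y in U) (f y * v y).

Definition weakly_null U (v_ : nat -> Rn -> R) :=
  (forall k, H10 U (v_ k)) /\ weak_cvg U v_ (fun=> 0).

Definition nu' (f_ : nat -> Rn -> R) (sigma : nat -> nat) U : \bar R :=
  (- ereal_inf [set limn_einf (fun k => (energy (f_ (sigma k)) (v_ k) U)%:E)
               | v_ in weakly_null U])%E.

Definition nu'' (f_ : nat -> Rn -> R) (sigma : nat -> nat) U : \bar R :=
  (- ereal_inf [set limn_esup (fun k => (energy (f_ (sigma k)) (v_ k) U)%:E)
               | v_ in weakly_null U])%E.

End sobolev.

(* The term of index k below is the term of index k + 1 of a sequence indexed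
   by 1, 2, ..., which is why the 1/k of the definition of R_k reads
   1/(k + 1). *)
Section construction.
Context {R : realType} {n : nat}.
Notation Rn := 'rV[R]_n.
Variables (rad : R) (r_ : nat -> R).
Local Notation B2 := (eball (0 : Rn) (2 * rad)).

Definition c_seq (k : nat) : R :=
  Num.sqrt 2 / Hm1_norm B2 (functional_of B2 \1_(eball 0 (r_ k))).

Definition g_seq (k : nat) : Rn -> R :=
  fun y => c_seq k * \1_(eball 0 (r_ k)) y.

Definition R_seq (u_ : nat -> Rn -> R) (k : nat) : R :=
  r_ k + k.+1%:R^-1
  + (\int[lebesgue_rV R n]_(y in B2) (u_ k y ^+ 2)) `^ (4^-1).

Definition f_seq (x_ : nat -> Rn) (k : nat) : Rn -> R :=
  fun y => g_seq k (y - x_ k).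

End construction.

(* Main.v *)
From HB Require Import structures.
Require Import Defs.
From mathcomp Require Import all_boot all_order all_algebra.
From mathcomp Require Import all_classical all_reals all_analysis.
From mathcomp Require Import measurable_realfun.
From mathcomp Require Import ring lra.
Import Order.TTheory GRing.Theory Num.Theory.
Import numFieldNormedType.Exports.
Local Open Scope classical_set_scope.
Local Open Scope ring_scope.
Set Implicit Arguments.
Unset Strict Implicit.
Unset Printing Implicit Defensive.

(** Let sigma be given. The ball B(x_k, R_k) is contained in U0 while x_k tends to
    the boundary point x0; therefore R_k <= |x_k - x0|, and R_k tends to 0. With
    rho_k half-way between r_k and R_k, one can extract from sigma a subsequence
    along which the balls B(x_k, rho_k) are pairwise disjoint
    ([disjoint_subsequence]). The open set U is the union of the balls of even
    rank in this subsequence.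

    Along the odd ranks f_k vanishes in U, so the energy is half the Dirichlet
    integral: it is nonnegative on the whole space. Along the even ranks there is
    room in U for a competitor, the translate of u_k to x_k multiplied by a cutoff
    phi_k which is 1 on B(x_k, r_k) and vanishes outside B(x_k, rho_k)
    ([competitor]). The normalization of c_k means that the integrals of
    |grad u_k|^2 and of g_k u_k are both equal to 2 ([poisson_energy]). The cutoff
    does not change the second one. It adds to the gradient the term
    u_k grad phi_k, whose L^2 norm is at most of the order of
    (int u_k^2)^(1/2) / (R_k - r_k); the definition of R_k makes it tend to 0
    ([R_seq_pow4]). Hence the energy of the competitor is at most - 1/4
    eventually. Completed by 0, the competitors form a bounded sequence with
    pairwise orthogonal gradients, because their supports are disjoint, and such a
    sequence tends weakly to 0 by the Bessel inequality
    ([orthogonal_weakly_null]). So - nu' is at most - 1/4 whereas - nu'' is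
    nonnegative, and the same sequences separate the Gamma-liminf from the
    Gamma-limsup at 0 ([nonconvergence]).

    The facts about H^1_0 behind this are obtained directly from its definition by
    means of weak gradients and approximating test functions. The weak gradient is
    unique because the partial derivatives of test functions are test functions
    ([H10_gradient_uniq]), the Poincare inequality comes from testing it against a
    coordinate times an approximating function ([poincare]), and test functions
    belong to H^1_0 because their partial derivatives have integral 0, by
    translation invariance of the Lebesgue measure ([integral_partial_test]). The
    Poincare inequality and the existence of cutoffs ensure that the dual norm in
    the definition of c_k is finite and positive. *)

(** * Borel sets and Lebesgue measure of the Euclidean space *)

Section euclidean_space_measure.
Context {R : realType}.

(** Open ball of the maximum norm, written with coordinates because its preimage
    under [cons_rV] is then a product of the same kind. *)
Definition box n (a : 'rV[R]_n) (e : R) : set 'rV[R]_n :=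
  [set y | forall i, `|y 0 i - a 0 i| < e].

Lemma measurable_box n (a : 'rV[R]_n) e : measurable (box a e).
Proof.
rewrite (_ : box a e = \bigcap_(i in [set: 'I_n])
    ((fun y : 'rV[R]_n => y 0 i) @^-1` [set t | `|t - a 0 i| < e])); last first.
  by apply/seteqP; split => y /= ya i => [_|]; exact: ya.
apply: fin_bigcap_measurable; first exact: finite_finset.
move=> i _; rewrite -[X in measurable X]setTI; apply: measurable_coord => //.
rewrite (_ : [set t | _] = `]a 0 i - e, a 0 i + e[%classic) //.
by apply/seteqP; split => t /=; rewrite in_itv/= ltr_distl.
Qed.

(** The sigma-algebra is the one generated by the coordinates. An open set is
    the union of the boxes with rational centre and radius 1/(k+1) that it
    contains, and there are only countably many of these. *)
Lemma open_measurable_rV n (A : set 'rV[R]_n) : open A -> measurable A.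
Proof.
move=> oA.
pose F (p : 'rV[rat]_n * nat) : set 'rV[R]_n :=
  let B := box (map_mx ratr p.1) p.2.+1%:R^-1 in
  if `[< B `<=` A >] then B else set0.
rewrite (_ : A = \bigcup_(k in [set: nat])
    oapp F set0 (unpickle k)); last first.
  apply/seteqP; split => [x Ax|x [k _]]; last first.
    case: unpickle => //= p; rewrite /F; case: asboolP => // + xB; exact.
  have /nbhs_ballP[e /= e0 eA] : nbhs x A by exact: open_nbhs_nbhs.
  (* x and any other point of the box are both within 1/(k+1) of its centre *)
  have [k ke] : exists k : nat, k.+1%:R^-1 < e / 2.
    have /cvgr0_norm_lt/(_ _ (divr_gt0 e0 (ltr0n _ 2)))[k _ /(_ k (leqnn k))] :=
      @cvg_harmonic R.
    by rewrite /harmonic/= => kP; exists k; rewrite (le_lt_trans (ler_norm _)).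
  have k0 : 0 < k.+1%:R^-1 :> R by rewrite invr_gt0.
  have qP i : exists q : rat, `|x 0 i - ratr q| < k.+1%:R^-1.
    have [|q] := @rat_in_itvoo R (x 0 i - k.+1%:R^-1) (x 0 i + k.+1%:R^-1).
      by rewrite ltrD2l gtrN.
    by rewrite in_itv/= -ltr_distl distrC; exists q.
  pose q := \row_i projT1 (cid (qP i)).
  exists (pickle (q, k)) => //; rewrite pickleK /= /F/=.
  have -> : `[< box (map_mx ratr q) k.+1%:R^-1 `<=` A >].
    apply/asboolP => y yq; apply: eA; split => // i j.
    rewrite (ord1 i) /ball /=.
    have := yq j; rewrite !mxE; move: (projT2 (cid (qP j))) => /=.
    set t := ratr _; set d := _^-1 in ke k0 * => xt yt.
    have := ler_distD t (x 0 j) (y 0 j); rewrite (distrC t); lra.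
  by move=> i /=; rewrite !mxE; exact: (projT2 (cid (qP i))).
apply: bigcup_measurable => k _; case: unpickle => //= p.
by rewrite /F; case: ifPn => // _; exact: measurable_box.
Qed.

Lemma continuous_measurable_rV n (f : 'rV[R]_n -> R) (D : set 'rV[R]_n) :
  continuous f -> measurable_fun D f.
Proof.
move=> cf; apply: (measurable_funS measurableT) => //.
apply: (measurability _ (RGenOpens.measurableE R)).
move=> _ [_ [a [b ->]] <-]; rewrite setTI.
apply: open_measurable_rV; apply: open_comp => //; exact: interval_open.
Qed.

Lemma measurable_shift n (a : 'rV[R]_n) : measurable_fun setT (fun y : 'rV[R]_n => y + a).
Proof.
apply: measurable_fun_coord => i; under eq_fun do rewrite mxE.
by apply: measurable_funD => //; exact: measurable_coord.
Qed.

Lemma lebesgue_measure_shift (a : R) (A : set R) : measurable A ->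
  lebesgue_measure ((fun y : R => y + a) @^-1` A) = lebesgue_measure A.
Proof.
move=> mA.
have mf : measurable_fun setT ((fun y => y + a) : measurableTypeR R -> measurableTypeR R).
  exact: measurable_funD.
pose f : {mfun _ >-> _} := HB.pack ((fun y => y + a) : measurableTypeR R -> measurableTypeR R)
  (isMeasurableFun.Build _ _ _ _ _ mf).
apply/esym.
suff H X : ocitv X -> lebesgue_measure X = pushforward lebesgue_measure f X.
  exact: (lebesgue_measure_unique H mA).
move=> [[u v] _ <-].
rewrite /pushforward /= (_ : _ @^-1` _ = `]u - a, v - a]%classic); last first.
  by apply/seteqP; split => t /=; rewrite !in_itv/= ltrBlDr lerBrDr.
rewrite !lebesgue_measure_itv /= !lte_fin ltrD2r; case: ifP => // _.
by rewrite -!EFinB; congr EFin; lra.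
Qed.

(** Induction on the dimension: the sections of a shifted set are shifted
    sections of the set, so that the shift only moves the variable of the outer
    integral, on the line. *)
Lemma lebesgue_rV_shift n (a : 'rV[R]_n) (A : set 'rV[R]_n) : measurable A ->
  lebesgue_rV R n ((fun y : 'rV[R]_n => y + a) @^-1` A) = lebesgue_rV R n A.
Proof.
elim: n a A => [a A _|n IH a A mA].
  by congr (lebesgue_rV R 0 _); apply/seteqP; split => y /=; rewrite (thinmx0 y) (thinmx0 (_ + _)).
rewrite /= /lebesgue_step /pushforward /= /product_measure1.
pose h : R -> R := fun t => t + a 0 0.
have mh : measurable_fun setT (h : measurableTypeR R -> measurableTypeR R).
  exact: measurable_funD.
pose B := @cons_rV R n @^-1` A.
have mB : measurable B.
  by have := @measurable_cons_rV R n measurableT _ mA; rewrite setTI.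
pose f t := lebesgue_rV R n (xsection B t).
have mx s : measurable (xsection B s) by exact: measurable_xsection.
pose a' : 'rV[R]_n := \row_j a 0 (lift ord0 j).
have consE t y : cons_rV (t, y) + a = cons_rV (h t, y + a').
  by apply/rowP => j; rewrite !mxE; case: unliftP => [k ->|->] /=; rewrite ?mxE.
transitivity (\int[lebesgue_measure]_t f (h t))%E.
  apply: eq_integral => t _ /=; rewrite /f -(IH a' _ (mx (h t))).
  congr (lebesgue_rV R n _); apply/seteqP; split => y /=;
    by rewrite /xsection /= !inE /B /= consE.
have mf : measurable_fun setT (f : measurableTypeR R -> \bar R).
  exact: measurable_fun_xsection.
have f0 : {in [set: R], forall t, 0 <= f t}%E by move=> t _; exact: measure_ge0.
have := @ge0_integral_pushforward _ _ _ _ R _ mh lebesgue_measure _ _ measurableT mf f0.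
rewrite preimage_setT => <-.
by apply: eq_measure_integral => C mC _; exact: lebesgue_measure_shift.
Qed.

Lemma lebesgue_rV_box n (a : 'rV[R]_n) e : 0 <= e ->
  lebesgue_rV R n (box a e) = ((2 * e) ^+ n)%:E.
Proof.
move=> e0; elim: n a => [a|n IH a].
  by rewrite /= diracE mem_set// => -[].
rewrite [LHS]/= /lebesgue_step /pushforward.
rewrite (_ : _ @^-1` _ = `]a 0 0 - e, a 0 0 + e[%classic `*` box (\row_j a 0 (lift ord0 j)) e).
  rewrite product_measure1E//; last exact: measurable_box.
  rewrite IH exprS EFinM; congr (_ * _)%E.
  have := @lebesgue_measure_itv R `]a 0 0 - e, a 0 0 + e[; rewrite /= lte_fin => ->.
  case: ifPn => [_|ea]; first by rewrite -EFinB; congr EFin; ring.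
  have -> : e = 0 by move: ea; rewrite -leNgt => ea; lra.
  by rewrite mulr0.
apply/seteqP; split => -[t y] /=.
- move=> ty; split.
    by have := ty 0; rewrite mxE unlift_none/= in_itv/= ltr_distl.
  by move=> i; have := ty (lift 0 i); rewrite !mxE liftK.
- move=> [ta ya] i; rewrite mxE; case: unliftP => [j ->|->]/=.
    by have := ya j; rewrite mxE.
  by move: ta; rewrite in_itv/= ltr_distl.
Qed.

Lemma ge0_integral_shift n (a : 'rV[R]_n) (D : set 'rV[R]_n) (f : 'rV[R]_n -> \bar R) :
  measurable D -> measurable_fun D f -> (forall y, 0 <= f y)%E ->
  (\int[lebesgue_rV R n]_(y in (fun y : 'rV[R]_n => (y + a)%R) @^-1` D) f (y + a)%R =
  \int[lebesgue_rV R n]_(y in D) f y)%E.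
Proof.
move=> mD mg g0.
have := ge0_integral_pushforward (measurable_shift a) (lebesgue_rV R n) mD mg (in1W g0).
move=> /= <-.
apply: eq_measure_integral; first exact: measurable_shift.
by move=> mh C mC _; exact: lebesgue_rV_shift.
Qed.

Lemma Rintegral_shift n (a : 'rV[R]_n) (D : set 'rV[R]_n) (f : 'rV[R]_n -> R) :
  measurable D -> measurable_fun D f ->
  \int[lebesgue_rV R n]_(y in (fun y : 'rV[R]_n => y + a) @^-1` D) f (y + a) =
  \int[lebesgue_rV R n]_(y in D) f y.
Proof.
move=> mD mf; congr fine; rewrite [LHS]integralE [RHS]integralE.
have mEf : measurable_fun D (EFin \o f) by exact/measurable_EFinP.
have mp := measurable_funepos mEf; have mn := measurable_funeneg mEf.
congr (_ - _)%E.
- rewrite -(ge0_integral_shift a mD mp) => [|y]; last exact: funepos_ge0.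
  by apply: eq_integral => y _; rewrite -[RHS]/((_ \o (fun y : 'rV[R]_n => y + a)) y) -funepos_comp.
- rewrite -(ge0_integral_shift a mD mn) => [|y]; last exact: funeneg_ge0.
  by apply: eq_integral => y _; rewrite -[RHS]/((_ \o (fun y : 'rV[R]_n => y + a)) y) -funeneg_comp.
Qed.

End euclidean_space_measure.

(** * Functions of one variable that are flat at the origin *)

Section flat_functions.
Context {R : realType}.

(** The functions t^-n exp(-1/t), extended by 0 to the negative half-line. The
    derivative of each is a linear combination of the next two, which makes all
    of them smooth. *)
Definition flat (n : nat) (t : R) : R :=
  if 0 < t then t^-1 ^+ n * expR (- t^-1) else 0.

Lemma flat_ge0 n t : 0 <= flat n t.
Proof.
by rewrite /flat; case: ifP => // t0; rewrite mulr_ge0 ?expR_ge0// exprn_ge0// invr_ge0 ltW.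
Qed.

(** With y = 1/t this is y^n / n! <= exp y. *)
Lemma flat_exp n t : 0 < t -> flat n t <= n`!%:R.
Proof.
move=> t0; rewrite /flat t0 expRN ler_pdivrMr ?expR_gt0//.
have y0 : 0 <= t^-1 by rewrite invr_ge0 ltW.
case: n => [|n]; first by rewrite expr0 fact0 mul1r -{1}expR0 ler_expR.
have := expR_ge1Dxn n y0; set y := t^-1.
have f0 : (0 : R) < n.+1`!%:R by rewrite ltr0n fact_gt0.
move=> h; rewrite mulrC -ler_pdivrMr//; apply: le_trans h; lra.
Qed.

Lemma flat_le n t : flat n t <= n.+1`!%:R * `|t|.
Proof.
have [t0|t0] := ltP 0 t; last by rewrite /flat ltNge t0/= mulr_ge0.
rewrite gtr0_norm// -ler_pdivrMr//; apply: le_trans (flat_exp n.+1 t0).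
by rewrite /flat t0 exprS mulrC mulrA.
Qed.

Lemma flatS n t : flat n t = t * flat n.+1 t.
Proof.
rewrite /flat; case: ifP => t0; last by rewrite mulr0.
by rewrite exprS !mulrA mulfV ?mul1r// gt_eqF.
Qed.

(** At the origin the difference quotient of [flat n] is [flat n.+1], which is
    dominated by a multiple of |t|. *)
Lemma is_derive_flat n (t : R) :
  is_derive t (1 : R) (flat n) (flat n.+2 t - n%:R * flat n.+1 t).
Proof.
have [t0|t0|->] := ltgtP t 0.
- apply: (@near_eq_is_derive _ _ _ (cst 0)).
    near=> s; rewrite /flat ifF//; apply/negbTE; rewrite -leNgt; apply: ltW.
    by near: s; exact: lt_nbhsl.
  by rewrite /flat !ifF ?mulr0 ?subr0; [exact: is_derive_cst|..]; apply: lt_gtF.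
- apply: (@near_eq_is_derive _ R^o R^o (fun s : R => s^-1 ^+ n * expR (- s^-1) : R^o)).
    near=> s; rewrite /flat ifT//.
    by near: s; exact: lt_nbhsr.
  have d1 : is_derive t 1 (fun s : R => s^-1) (- t ^- 2 *: 1).
    by apply: (@is_deriveV _ id) => //; rewrite gt_eqF.
  have d2 : is_derive t 1 (fun s : R => (s^-1) ^+ n) (n%:R * t^-1 ^+ n.-1 *: (- t ^- 2 *: 1)).
    by have := is_deriveX n d1; rewrite exprfctE.
  have d3 : is_derive t 1 (fun s : R => expR (- s^-1)) (expR (- t^-1) * (- (- t ^- 2 *: 1))).
    by apply: (@is_derive1_comp _ expR).
  apply: (is_derive_eq (is_deriveM d2 d3)).
  rewrite /flat t0 /GRing.scale /= -exprVn.
  case: n {d2} => [|n] /=; first by rewrite expr0 !expr2 ; ring.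
  by rewrite !exprS expr0; ring.
- have -> : flat n.+2 0 - n%:R * flat n.+1 0 = 0.
    by rewrite /flat ltxx mulr0 subr0.
  have h : (fun h : R => h^-1 *: ((flat n \o shift 0) (h *: 1) - flat n 0)) @ 0^' --> (0 : R).
    apply/cvgr0Pnorm_lt => e e0; near=> s.
    have s0 : s != 0 by near: s; exact: nbhs_dnbhs_neq.
    rewrite /= addr0 [s *: 1]mulr1 [flat n 0]/flat ltxx subr0 flatS.
    rewrite [_ *: _]mulrA mulVf// mul1r ger0_norm ?flat_ge0//.
    apply: le_lt_trans (flat_le _ _) _.
    rewrite mulrC -ltr_pdivlMr ?ltr0n ?fact_gt0//.
    near: s; apply: dnbhs0_lt; by rewrite divr_gt0// ltr0n fact_gt0.
  by apply: DeriveDef; [apply/cvg_ex; exists 0|exact/cvg_lim].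
Unshelve. all: by end_near. Qed.

End flat_functions.

(** * Smooth functions of several variables *)

Section smooth_functions.
Context {R : realType} {n : nat}.
Notation Rn := 'rV[R]_n.
Implicit Types (f g : Rn -> R) (U V : set Rn).

(** Existence and continuity of the iterated partial derivatives up to order m.
    Counting the order turns the stability properties of smooth functions into
    inductions. *)
Fixpoint Cm (m : nat) f : Prop :=
  continuous f /\
  if m is m'.+1 then
    forall i : 'I_n, (forall y, derivable f y (delta_mx 0 i)) /\ Cm m' (partial i f)
  else True.

(** The last direction of the list is the first one along which [foldr]
    differentiates. *)
Lemma smoothP f : smooth f <-> forall m, Cm m f.
Proof.
split=> [+ m|]; last first.
  move=> Cf s; elim/last_ind: s f Cf => [|s i IH] f Cf.
    by split=> [|i y]; [have [] := Cf 0%N|have [_ /(_ i)[]] := Cf 1%N].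
  by rewrite foldr_rcons; apply: IH => m; have [_ /(_ i)[]] := Cf m.+1.
elim: m f => [|m IH] f sf /=; first by have [] := sf [::].
have [cf df] := sf [::]; split=> // i; split=> [y|]; first exact: df.
by apply: IH => s; rewrite -foldr_rcons.
Qed.

Lemma CmS m f : Cm m.+1 f -> Cm m f.
Proof.
elim: m f => [|m IH] f [cf df]; first by [].
by split=> // i; have [dfi Cf] := df i; split=> //; exact: IH.
Qed.

Lemma CmD m f g : Cm m f -> Cm m g -> Cm m (fun y => f y + g y).
Proof.
elim: m f g => [|m IH] f g [cf df] [cg dg].
  by split=> // y; apply: continuousD; [exact: cf|exact: cg].
split=> [y|i]; first by apply: continuousD; [exact: cf|exact: cg].
have [dfi Cf] := df i; have [dgi Cg] := dg i.
split=> [y|]; first by apply: derivableD.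
rewrite (_ : partial i _ = (fun y => partial i f y + partial i g y)); first exact: IH.
by apply/funext => y; rewrite /partial (deriveD (dfi y) (dgi y)).
Qed.

Lemma CmM m f g : Cm m f -> Cm m g -> Cm m (fun y => f y * g y).
Proof.
elim: m f g => [|m IH] f g Cmf Cmg; have [cf df] := Cmf; have [cg dg] := Cmg.
  by split=> // y; apply: continuousM; [exact: cf|exact: cg].
split=> [y|i]; first by apply: continuousM; [exact: cf|exact: cg].
have [dfi Cf] := df i; have [dgi Cg] := dg i.
split=> [y|]; first by apply: derivableM.
rewrite (_ : partial i _ = (fun y => f y * partial i g y + g y * partial i f y)).
  by apply: CmD; apply: IH => //; exact: CmS.
by apply/funext => y; rewrite /partial (deriveM (dfi y) (dgi y)).
Qed.

Lemma Cm_cst m (a : R) : Cm m (fun _ => a).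
Proof.
elim: m a => [|m IH] a; (split; first exact: cst_continuous) => // i.
split=> [y|]; first exact: derivable_cst.
rewrite (_ : partial i _ = fun=> 0); first exact: IH.
by apply/funext => y; rewrite /partial derive_cst.
Qed.

Lemma is_derive_coord (i : 'I_n) (y v : Rn) : is_derive y v (fun z => z 0 i) (v 0 i).
Proof.
have h : (fun h : R => h^-1 *: (((fun z : Rn => z 0 i) \o shift y) (h *: v) - y 0 i)) @ 0^'
    --> v 0 i.
  apply: cvg_near_cst; near=> s.
  have s0 : s != 0 by near: s; exact: nbhs_dnbhs_neq.
  by rewrite /= !mxE addrK [_ *: _]mulrA mulVf// mul1r.
by apply: DeriveDef; [apply/cvg_ex; exists (v 0 i)|exact/cvg_lim].
Unshelve. all: by end_near. Qed.

Lemma Cm_coord m (i : 'I_n) : Cm m (fun y => y 0 i).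
Proof.
case: m => [|m]; (split; first by move=> y; exact: coord_continuous) => // j.
split=> [y|]; first by have [] := is_derive_coord i y (delta_mx 0 j).
rewrite (_ : partial j _ = fun=> (delta_mx 0 j : Rn) 0 i); first exact: Cm_cst.
by apply/funext => y; rewrite /partial; have [_ ->] := is_derive_coord i y (delta_mx 0 j).
Qed.

(** Restricted to the line through y directed by v, this is the chain rule in
    one variable. *)
Lemma is_derive_comp_rV (h : R -> R) f (y v : Rn) (a b : R) :
  is_derive (f y) 1 h a -> is_derive y v f b ->
  is_derive y v (h \o f) (a * b).
Proof.
move=> hd [df fb].
have lineE (g : Rn -> R) : 'D_v g y = 'D_1 (fun t : R => g (t *: v + y)) 0.
  rewrite /derive; set g1 := fun h => h^-1 *: _; set g2 := fun h => h^-1 *: _.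
  suff -> : g1 = g2 by [].
  by rewrite funeqE /g1 /g2 => t /=; rewrite addr0 scale0r add0r [_%:A]mulr1.
have [dh1 hE] : is_derive (0 : R) (1 : R) (h \o (fun t : R => f (t *: v + y))) (a * b).
  apply: is_derive1_comp; first by rewrite scale0r add0r.
  by apply: DeriveDef; [exact: (proj1 (derivable1P _ _ _) df)|rewrite -fb lineE].
by apply: DeriveDef; [exact: (proj2 (derivable1P _ _ _) dh1)|rewrite -hE lineE].
Qed.

(** A derivative of [flat k \o f] is a combination of functions of the same
    form, with larger k, multiplied by a derivative of f: the induction on m has
    to treat all k at once. *)
Lemma Cm_flat m k f : Cm m f -> Cm m (flat k \o f).
Proof.
have cflat j : continuous (@flat R j).
  move=> t; apply: differentiable_continuous; apply/derivable1_diffP.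
  by have [] := is_derive_flat j t.
elim: m k f => [|m IH] k f Cf; have [cf df] := Cf.
  by split=> // y; apply: continuous_comp; [exact: cf|exact: cflat].
split=> [y|i]; first by apply: continuous_comp; [exact: cf|exact: cflat].
have [dfi Cpf] := df i.
have D y := is_derive_comp_rV (is_derive_flat k (f y)) (derivableP (dfi y)).
split=> [y|]; first by have [] := D y.
rewrite (_ : partial i _ = fun y =>
    ((flat k.+2 \o f) y + (- k%:R) * (flat k.+1 \o f) y) * partial i f y).
  apply: CmM => //; apply: CmD; first by apply: IH; exact: CmS.
  by apply: CmM; [exact: Cm_cst|apply: IH; exact: CmS].
by apply/funext => y; rewrite /partial; have [_ ->] := D y; rewrite mulNr.
Qed.

Lemma smoothD f g : smooth f -> smooth g -> smooth (fun y => f y + g y).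
Proof. by rewrite !smoothP => sf sg m; exact: CmD. Qed.

Lemma smoothM f g : smooth f -> smooth g -> smooth (fun y => f y * g y).
Proof. by rewrite !smoothP => sf sg m; exact: CmM. Qed.

Lemma smooth_cst (a : R) : smooth (fun _ : Rn => a).
Proof. by rewrite smoothP => m; exact: Cm_cst. Qed.

Lemma smooth_coord i : smooth (fun y : Rn => y 0 i).
Proof. by rewrite smoothP => m; exact: Cm_coord. Qed.

Lemma smooth_flat k f : smooth f -> smooth (flat k \o f).
Proof. by rewrite !smoothP => sf m; exact: Cm_flat. Qed.

Lemma smooth_continuous f : smooth f -> continuous f.
Proof. by move=> /(_ [::])[]. Qed.

Lemma smooth_derivable f i y : smooth f -> derivable f y (delta_mx 0 i).
Proof. by move=> /(_ [::])[]. Qed.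

Lemma smooth_partial i f : smooth f -> smooth (partial i f).
Proof. by move=> sf s; rewrite -foldr_rcons. Qed.

Lemma partialD i f g : smooth f -> smooth g ->
  partial i (fun y => f y + g y) = fun y => partial i f y + partial i g y.
Proof.
move=> sf sg; apply/funext => y.
by rewrite /partial (deriveD (smooth_derivable sf) (smooth_derivable sg)).
Qed.

Lemma partialM i f g : smooth f -> smooth g ->
  partial i (fun y => f y * g y) = fun y => f y * partial i g y + partial i f y * g y.
Proof.
move=> sf sg; apply/funext => y.
by rewrite /partial (deriveM (smooth_derivable sf) (smooth_derivable sg)) [X in _ + X]mulrC.
Qed.

Lemma partial_cst i (a : R) : partial i (fun _ : Rn => a) = fun=> 0.
Proof. by apply/funext => y; rewrite /partial derive_cst. Qed.

Lemma partial_coord i j (y : Rn) : partial i (fun y : Rn => y 0 j) y = (i == j)%:R.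
Proof.
by rewrite /partial; have [_ ->] := is_derive_coord j y (delta_mx 0 i); rewrite mxE eqxx eq_sym.
Qed.

End smooth_functions.

(** * Test functions *)

Section test_functions.
Context {R : realType} {n : nat}.
Notation Rn := 'rV[R]_n.
Implicit Types (f g phi psi : Rn -> R) (U V K : set Rn).

Definition support f : set Rn := closure [set y | f y != 0].

Lemma support_out f y : ~ support f y -> f y = 0.
Proof. by move=> nfy; apply/eqP/negPn/negP => fy; apply: nfy; exact: subset_closure. Qed.

Lemma sub_support f K : closed K -> (forall y, f y != 0 -> K y) -> support f `<=` K.
Proof.
move=> cK fK; rewrite /support [X in _ `<=` X](closure_id K).1//.
exact: closure_subset.
Qed.

Lemma rV_hausdorff : hausdorff_space Rn.
Proof. exact: norm_hausdorff. Qed.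

(** To recognize test functions without computing supports, it is enough to
    exhibit a compact set outside of which f vanishes. *)
Lemma test_functionW U K f : smooth f -> compact K -> K `<=` U ->
  (forall y, f y != 0 -> K y) -> test_function U f.
Proof.
move=> sf cK KU fK.
have sK : support f `<=` K by apply: sub_support => //; exact: compact_closed rV_hausdorff cK.
split=> //; last exact: subset_trans KU.
by apply: (subclosed_compact _ cK sK); exact: closed_closure.
Qed.

Lemma test_smooth U f : test_function U f -> smooth f. Proof. by case. Qed.

Lemma test_out U f y : test_function U f -> ~ U y -> f y = 0.
Proof. by move=> [_ _ fU] Uy; apply: support_out => /fU. Qed.

Lemma test_sub U V f : test_function U f -> support f `<=` V -> test_function V f.
Proof. by move=> [sf cf fU] fV. Qed.

Lemma test_mull U f g : smooth f -> test_function U g -> test_function U (fun y => f y * g y).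
Proof.
move=> sf [sg cg gU]; apply: (test_functionW _ cg gU); first exact: smoothM.
by move=> y fgy; apply: subset_closure => /=; apply: contra fgy => /eqP ->; rewrite mulr0.
Qed.

Lemma test_mulr U f g : test_function U f -> smooth g -> test_function U (fun y => f y * g y).
Proof. by move=> tf sg; under eq_fun do rewrite mulrC; exact: test_mull. Qed.

Lemma near_support_out f y : ~ support f y -> \forall z \near y, f z = 0.
Proof.
move=> fy; have oC : open (~` support f) by apply: closed_openC; exact: closed_closure.
by near=> z; apply: support_out; near: z; exact: open_nbhs_nbhs.
Unshelve. all: by end_near. Qed.

Lemma partial_supp f i y : partial i f y != 0 -> support f y.
Proof.
apply: contra_neqP => /near_support_out f0; rewrite /partial.
by rewrite (near_eq_derive (g := cst 0))// derive_cst.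
Qed.

Lemma test_partial U f i : test_function U f -> test_function U (partial i f).
Proof.
move=> [sf cf fU]; apply: (test_functionW _ cf fU); first exact: smooth_partial.
by move=> y; exact: partial_supp.
Qed.

Lemma test_scaleD U (a : R) f g : test_function U f -> test_function U g ->
  test_function U (fun y => a * f y + g y).
Proof.
move=> [sf cf fU] [sg cg gU].
apply: (@test_functionW _ (support f `|` support g)).
- by apply: smoothD => //; apply: smoothM => //; exact: smooth_cst.
- exact: compactU.
- by move=> y [/fU|/gU].
- move=> y; have [fy|fy] := eqVneq (f y) 0; last by move=> _; left; exact: subset_closure.
  by rewrite fy mulr0 add0r => gy; right; exact: subset_closure.
Qed.

Lemma test0 U : test_function U (fun=> 0).
Proof.
apply: (@test_functionW _ set0); [exact: smooth_cst|exact: compact0|by []|].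
by move=> y; rewrite eqxx.
Qed.

Lemma test_bounded U f : test_function U f -> exists2 M, 0 < M & forall y, `|f y| <= M.
Proof.
move=> [sf cf fU].
have [M [_ M1]] : bounded_set (f @` support f).
  apply: compact_bounded; apply: continuous_compact => //.
  by apply: continuous_subspaceT; exact: smooth_continuous.
have M0 : 0 < `|M| + 1 by rewrite ltr_wpDl.
exists (`|M| + 1) => // y; have [fy|/support_out ->] := pselect (support f y).
  2: by rewrite normr0 ltW.
by apply: (M1 (`|M| + 1)); [rewrite (le_lt_trans (ler_norm _))// ltrDl|exists y].
Qed.

Lemma shift_continuous (a : Rn) : continuous (fun y : Rn => y + a).
Proof.
move=> y; apply: (@continuousD _ _ _ id (cst a)); first exact: cvg_id.
exact: cst_continuous.
Qed.

Lemma partial_shift f i (a : Rn) :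
  partial i (fun y : Rn => f (y + a)) = fun y => partial i f (y + a).
Proof.
apply/funext => y; rewrite /partial /derive.
set g1 := fun h => h^-1 *: _; set g2 := fun h => h^-1 *: _.
suff -> : g1 = g2 by [].
by rewrite funeqE /g1 /g2 => t /=; rewrite addrA.
Qed.

Lemma smooth_shift f (a : Rn) : smooth f -> smooth (fun y : Rn => f (y + a)).
Proof.
have csh (g : Rn -> R) : continuous g -> continuous (fun y : Rn => g (y + a)).
  move=> cg y; apply: (@continuous_comp _ _ _ (fun y : Rn => y + a) g); last exact: cg.
  exact: shift_continuous.
move=> sf; apply/smoothP => m; move/smoothP : sf => /(_ m).
elim: m f => [|m IH] f [cf df]; first by split=> //; exact: csh.
split; first exact: csh.
move=> i; have [dfi Cf] := df i; split; last by rewrite partial_shift; exact: IH.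
move=> y; have := dfi (y + a); rewrite /derivable.
set g1 := fun h => h^-1 *: _; set g2 := fun h => h^-1 *: _.
suff -> : g1 = g2 by [].
by rewrite funeqE /g1 /g2 => t /=; rewrite addrA.
Qed.

Lemma test_shift U f (a : Rn) : test_function U f ->
  test_function ((fun y : Rn => y + a) @^-1` U) (fun y => f (y + a)).
Proof.
move=> [sf cf fU].
apply: (@test_functionW _ ((fun y : Rn => y - a) @` support f)).
- exact: smooth_shift.
- apply: continuous_compact => //; apply: continuous_subspaceT.
  by move=> y; exact: shift_continuous.
- by move=> _ [y /fU Uy <-] /=; rewrite subrK.
- by move=> y fy; exists (y + a); rewrite ?addrK//; exact: subset_closure.
Qed.

End test_functions.

(** * The Euclidean norm and its balls *)

Section euclidean_norm.
Context {R : realType} {n : nat}.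
Notation Rn := 'rV[R]_n.
Implicit Types (x y z : Rn).

Lemma edotC x y : edot x y = edot y x.
Proof. by apply: eq_bigr => i _; rewrite mulrC. Qed.

Lemma edotDl x y z : edot (x + y) z = edot x z + edot y z.
Proof. by rewrite -big_split; apply: eq_bigr => i _; rewrite mxE mulrDl. Qed.

Lemma edotZl (a : R) x y : edot (a *: x) y = a * edot x y.
Proof. by rewrite /edot big_distrr /=; apply: eq_bigr => i _; rewrite mxE mulrA. Qed.

Lemma edotDr x y z : edot z (x + y) = edot z x + edot z y.
Proof. by rewrite edotC edotDl !(edotC z). Qed.

Lemma edotZr (a : R) x y : edot x (a *: y) = a * edot x y.
Proof. by rewrite edotC edotZl edotC. Qed.

Lemma edotNl x y : edot (- x) y = - edot x y.
Proof. by rewrite -scaleN1r edotZl mulN1r. Qed.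

Lemma edotNr x y : edot x (- y) = - edot x y.
Proof. by rewrite edotC edotNl edotC. Qed.

Lemma edot0l x : edot 0 x = 0.
Proof. by rewrite -(scale0r 0) edotZl mul0r. Qed.

Lemma edot_ge0 x : 0 <= edot x x.
Proof. by apply: sumr_ge0 => i _; rewrite -expr2 sqr_ge0. Qed.

Lemma sqr_coord_le x i : x 0 i ^+ 2 <= edot x x.
Proof.
rewrite /edot (bigD1 i)//= expr2 lerDl; apply: sumr_ge0 => j _.
by rewrite -expr2 sqr_ge0.
Qed.

Lemma edot_eq0 x : (edot x x == 0) = (x == 0).
Proof.
apply/eqP/eqP => [x0|->]; last exact: edot0l.
apply/rowP => i; rewrite mxE; apply/eqP.
by rewrite -sqrf_eq0 eq_le sqr_ge0 andbT -x0 sqr_coord_le.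
Qed.

Lemma enorm_ge0 x : 0 <= enorm x. Proof. exact: sqrtr_ge0. Qed.

Lemma enorm_sqr x : enorm x ^+ 2 = edot x x.
Proof. by rewrite sqr_sqrtr// edot_ge0. Qed.

Lemma enorm_lt x (r : R) : 0 <= r -> (enorm x < r) = (edot x x < r ^+ 2).
Proof. by move=> r0; rewrite -enorm_sqr ltr_pXn2r// nnegrE enorm_ge0. Qed.

Lemma enorm_le x (r : R) : 0 <= r -> (enorm x <= r) = (edot x x <= r ^+ 2).
Proof. by move=> r0; rewrite -enorm_sqr ler_pXn2r// nnegrE enorm_ge0. Qed.

Lemma coord_le_enorm x i : `|x 0 i| <= enorm x.
Proof.
by rewrite -(@ler_pXn2r _ 2)// ?nnegrE ?enorm_ge0// enorm_sqr real_normK ?num_real// sqr_coord_le.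
Qed.

(** Expand the square of <y, y> x - <x, y> y. *)
Lemma edot_CS x y : edot x y <= enorm x * enorm y.
Proof.
have [y0|y0] := eqVneq y 0.
  by rewrite y0 edotC edot0l mulr_ge0// enorm_ge0.
have yy : 0 < edot y y by rewrite lt_neqAle edot_ge0 eq_sym edot_eq0 y0.
have [xy|xy] := leP (edot x y) 0; first by rewrite (le_trans xy)// mulr_ge0// enorm_ge0.
rewrite -(@ler_pXn2r _ 2)// ?nnegrE ?mulr_ge0 ?enorm_ge0 ?(ltW xy)//.
rewrite exprMn !enorm_sqr.
have := edot_ge0 (edot y y *: x - edot x y *: y).
rewrite edotDl !edotDr !edotNl !edotNr !edotZl !edotZr (edotC y x).
move=> h; have : 0 <= edot y y * (edot x x * edot y y - edot x y ^+ 2).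
  by apply: le_trans h _; rewrite le_eqVlt; apply/orP; left; apply/eqP; ring.
by rewrite pmulr_rge0 // subr_ge0.
Qed.

Lemma enormD x y : enorm (x + y) <= enorm x + enorm y.
Proof.
rewrite -(@ler_pXn2r _ 2)// ?nnegrE ?addr_ge0 ?enorm_ge0//.
rewrite enorm_sqr edotDl !edotDr (edotC y x) sqrrD !enorm_sqr.
rewrite addrA -addrA mulr2n; have h := edot_CS x y.
by rewrite addrA lerD2r -addrA lerD2l lerD.
Qed.

Lemma enormN x : enorm (- x) = enorm x.
Proof. by rewrite /enorm edotNl edotNr opprK. Qed.

Lemma enormB x y : enorm (x - y) = enorm (y - x).
Proof. by rewrite -enormN opprB. Qed.

Lemma smooth_edot (a : Rn) : smooth (fun y => edot (y - a) (y - a)).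
Proof.
rewrite smoothP => m; rewrite /edot.
have sumC (s : seq 'I_n) (F : 'I_n -> Rn -> R) : (forall i, Cm m (F i)) ->
    Cm m (fun y => \sum_(i <- s) F i y).
  move=> CF; elim: s => [|i s IH].
    by under eq_fun do rewrite big_nil; exact: Cm_cst.
  by under eq_fun do rewrite big_cons; exact: CmD.
apply: sumC => i; under eq_fun do rewrite !mxE.
by apply: CmM; apply: CmD; (exact: Cm_coord || exact: Cm_cst).
Qed.

Lemma partial_edot (a : Rn) i y :
  partial i (fun y => edot (y - a) (y - a)) y = 2 * (y 0 i - a 0 i).
Proof.
rewrite /partial /edot.
have c j z : is_derive z (delta_mx 0 i : Rn) (fun y : Rn => (y - a) 0 j * (y - a) 0 j)
    (2 * (z 0 j - a 0 j) * (j == i)%:R).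
  have d : is_derive z (delta_mx 0 i : Rn) (fun y : Rn => (y - a) 0 j) ((j == i)%:R - 0).
    rewrite (_ : (fun _ => _) = (fun y : Rn => y 0 j) - cst (a 0 j)); last first.
      by apply/funext => t; rewrite !mxE.
    by apply: is_deriveB; have := is_derive_coord j z (delta_mx 0 i); rewrite mxE eqxx.
  apply: (is_derive_eq (is_deriveM d d)).
  by rewrite /GRing.scale/= !mxE subr0; ring.
rewrite (_ : (fun _ => _) = \sum_(j < n) (fun y : Rn => (y - a) 0 j * (y - a) 0 j)); last first.
  by apply/funext => t; rewrite fct_sumE.
have [_ ->] := is_derive_sum (fun j => c j y).
by rewrite (bigD1 i)//= eqxx mulr1 big1 ?addr0// => j /negbTE ->; rewrite mulr0.
Qed.

Lemma eball_open (a : Rn) (r : R) : open (eball a r).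
Proof.
have [r0|r0] := ltP r 0.
  rewrite (_ : eball a r = set0); first exact: open0.
  apply/seteqP; split => // y /= h.
  by have := lt_trans (le_lt_trans (enorm_ge0 _) h) r0; rewrite ltxx.
rewrite (_ : eball a r = (fun y => edot (y - a) (y - a)) @^-1` [set t | t < r ^+ 2]); last first.
  by apply/seteqP; split => y /=; rewrite /eball/= enorm_lt.
apply: open_comp; last exact: open_lt.
by move=> y _; exact/smooth_continuous/smooth_edot.
Qed.

Lemma cball_compact (a : Rn) (r : R) : 0 <= r -> compact [set y | enorm (y - a) <= r].
Proof.
move=> r0; apply: (@subclosed_compact _ _
  [set v : Rn | forall i, `[a 0 i - r, a 0 i + r]%classic (v 0 i)]).
- rewrite (_ : [set _ | _] =
      (fun y => edot (y - a) (y - a)) @^-1` [set t | t <= r ^+ 2]); last first.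
    by apply/seteqP; split => y /=; rewrite enorm_le.
  apply: closed_comp; last exact: closed_le.
  by move=> y _; exact/smooth_continuous/smooth_edot.
- apply: (@rV_compact R n (fun i => `[a 0 i - r, a 0 i + r]%classic)) => i.
  exact: segment_compact.
- move=> y /= ya i; rewrite in_itv/= -ler_distl.
  by apply: le_trans ya; have := coord_le_enorm (y - a) i; rewrite !mxE.
Qed.

Lemma eball_sub_box (a : Rn) (r : R) : eball a r `<=` box a r.
Proof.
move=> y; rewrite /eball/= => ya i; apply: le_lt_trans ya.
by have := coord_le_enorm (y - a) i; rewrite !mxE.
Qed.

End euclidean_norm.

(** * Cutoff functions *)

Section cutoff.
Context {R : realType} {n : nat}.
Notation Rn := 'rV[R]_n.

Let K : R := expR 1.

Let flat1 t : 1 <= t -> 1 <= K * flat 0 t.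
Proof.
move=> t1; have t0 : 0 < t by exact: lt_le_trans ltr01 t1.
by rewrite /flat t0 expr0 mul1r -expRD -{1}expR0 ler_expR subr_ge0 invf_le1.
Qed.

Let flat_le1 t : t <= 1 -> K * flat 0 t <= 1.
Proof.
move=> t1; rewrite /flat; case: ifPn => t0; last by rewrite mulr0.
by rewrite expr0 mul1r -expRD -[X in _ <= X]expR0 ler_expR subr_le0 invf_ge1.
Qed.

Let flat_eq0 k (t : R) : t <= 0 -> flat k t = 0.
Proof. by move=> t0; rewrite /flat ltNge t0. Qed.

Let K0 : 0 < K. Proof. exact: expR_gt0. Qed.

Let flat2_le (t : R) : `|flat 2 t| <= 2.
Proof.
rewrite ger0_norm ?flat_ge0//; have [t0|t0] := ltP 0 t; last by rewrite flat_eq0.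
exact: flat_exp.
Qed.

(** A smooth step obtained by composition, without quotients. The inner term K
    exp(-1/t) is 0 for t <= 0, and then the value is 1 - K exp(-1) = 0; it is at
    least 1 for t >= 1, and then the outer exponential vanishes. *)
Definition step (t : R) := 1 - K * flat 0 (1 - K * flat 0 t).

Lemma step_ge0 t : 0 <= step t.
Proof.
rewrite /step subr_ge0; apply: flat_le1.
by rewrite gerBl mulr_ge0 ?flat_ge0// ltW.
Qed.

Lemma step_le1 t : step t <= 1.
Proof. by rewrite /step gerBl mulr_ge0 ?flat_ge0// ltW. Qed.

Lemma step_eq1 t : 1 <= t -> step t = 1.
Proof. by move=> t1; rewrite /step (@flat_eq0 0 (1 - _)) ?mulr0 ?subr0// subr_le0 flat1. Qed.

Lemma step_eq0 t : t <= 0 -> step t = 0.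
Proof.
move=> t0; rewrite /step (flat_eq0 0 t0) mulr0 subr0 /flat ltr01 invr1 expr0 mul1r.
by rewrite -expRD subrr expR0 subrr.
Qed.

(** The derivative of [step]; [flat 2] is the derivative of [flat 0]. *)
Definition step' (t : R) := K ^+ 2 * flat 2 (1 - K * flat 0 t) * flat 2 t.

Lemma smooth_step f : smooth f -> smooth (fun y : Rn => step (f y)).
Proof.
move=> sf; rewrite /step.
have c (g : Rn -> R) : smooth g -> smooth (fun y => 1 - K * flat 0 (g y)).
  move=> sg; rewrite (_ : (fun _ => _) = fun y => 1 + (- K) * (flat 0 \o g) y); last first.
    by apply/funext => y /=; rewrite mulNr.
  apply: smoothD; first exact: smooth_cst.
  by apply: smoothM; [exact: smooth_cst|exact: smooth_flat].
exact/c/c.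
Qed.

Lemma partial_step f i y : smooth f ->
  partial i (fun y : Rn => step (f y)) y = step' (f y) * partial i f y.
Proof.
move=> sf.
pose h s : R := 1 - K * flat 0 s.
have c (t : R) : is_derive t (1 : R) h (- (K * flat 2 t)).
  have d1 := is_derive_flat 0 t; rewrite mul0r subr0 in d1.
  have := is_deriveB (is_derive_cst (1 : R) t 1) (is_deriveZ K d1).
  by rewrite sub0r.
have d := is_derive_comp_rV (@is_derive1_comp _ h h _ _ _ (c (h (f y))) (c (f y)))
  (derivableP (smooth_derivable (i := i) (y := y) sf)).
rewrite [LHS](@derive_val _ _ _ _ _ _ _ d) /step'.
by congr (_ * _); ring.
Qed.

Lemma step'_le t : `|step' t| <= 4 * K ^+ 2.
Proof.
have : 0 < K ^+ 2 by exact: exprn_gt0.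
rewrite /step'; move: (K ^+ 2) => L L0.
rewrite !normrM (gtr0_norm L0) -mulrA mulrC ler_pM2r//.
by rewrite (_ : 4 = 2 * 2 :> R) ?ler_pM ?flat2_le//; ring.
Qed.

Lemma step'_eq0 t : t <= 0 -> step' t = 0.
Proof. by move=> t0; rewrite /step' (flat_eq0 2 t0) mulr0. Qed.

(** Twice the bound of [step']; the factor 2 comes from the gradient of the
    square of the norm. *)
Definition cutoff_cst : R := 8 * expR 1 ^+ 2.

(** Apply the step to (rho^2 - |y - a|^2) / (rho^2 - r^2), which is at least 1
    on the small ball and nonpositive outside the large one. Since the
    derivative of the step vanishes outside the large ball, |y - a| may be
    bounded by rho + r in the gradient, which leaves the gap rho - r as only
    denominator. *)
Lemma cutoff_exists (a : Rn) (r rho : R) : 0 < r -> r < rho ->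
  exists phi : Rn -> R,
  [/\ smooth phi, forall y, phi y != 0 -> enorm (y - a) <= rho,
      forall y, 0 <= phi y <= 1, forall y, enorm (y - a) <= r -> phi y = 1 &
      forall y, edot (grad phi y) (grad phi y) <= (cutoff_cst / (rho - r)) ^+ 2].
Proof.
move=> r0 rrho; have rho0 : 0 < rho := lt_trans r0 rrho.
pose d := rho ^+ 2 - r ^+ 2.
have d0 : 0 < d by rewrite subr_gt0 ltr_pXn2r ?nnegrE// ltW.
pose q (y : Rn) := d^-1 * (rho ^+ 2 + (-1) * edot (y - a) (y - a)).
have sq : smooth q.
  apply: smoothM; first exact: smooth_cst.
  apply: smoothD; first exact: smooth_cst.
  by apply: smoothM; [exact: smooth_cst|exact: smooth_edot].
have q_le0 y : rho <= enorm (y - a) -> q y <= 0.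
  move=> h; rewrite /q pmulr_rle0 ?invr_gt0// mulN1r subr_le0 -enorm_sqr.
  by rewrite ler_pXn2r// nnegrE ?enorm_ge0// ltW.
exists (fun y => step (q y)); split.
- exact: smooth_step.
- by move=> y; apply: contraR; rewrite -ltNge => h; rewrite step_eq0// q_le0// ltW.
- by move=> y; rewrite step_ge0 step_le1.
- move=> y yr; apply: step_eq1.
  rewrite /q mulrC ler_pdivlMr// mul1r /d mulN1r lerD2l lerN2 -enorm_sqr.
  by rewrite ler_pXn2r// nnegrE ?enorm_ge0// ltW.
- move=> y.
  have gE : grad (fun y => step (q y)) y = (step' (q y) * (d^-1 * -2)) *: (y - a).
    apply/rowP => i; rewrite mxE partial_step// !mxE -mulrA; congr (_ * _).
    rewrite /q (partialM i (smooth_cst d^-1)); last first.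
      apply: smoothD; first exact: smooth_cst.
      by apply: smoothM; [exact: smooth_cst|exact: smooth_edot].
    rewrite partial_cst mul0r addr0 partialD; [|exact: smooth_cst|]; last first.
      by apply: smoothM; [exact: smooth_cst|exact: smooth_edot].
    rewrite partial_cst add0r partialM; [|exact: smooth_cst|exact: smooth_edot].
    by rewrite partial_cst mul0r addr0 partial_edot; ring.
  rewrite gE edotZl edotZr -enorm_sqr mulrA -expr2 -exprMn.
  have [yrho|yrho] := leP rho (enorm (y - a)).
    by rewrite step'_eq0 ?q_le0// !mul0r expr0n/= sqr_ge0.
  rewrite -[X in X ^+ 2 <= _]/(_ * _) -[leLHS]real_normK ?num_real//.
  have C0 : 0 <= cutoff_cst by rewrite mulr_ge0// exprn_ge0// ltW.
  rewrite ler_pXn2r ?nnegrE ?normr_ge0 ?divr_ge0 ?subr_ge0 ?(ltW rrho)//.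
  have hs := step'_le (q y); move: (step' (q y)) hs => s hs.
  rewrite !normrM normrN (ger0_norm (enorm_ge0 _)) (@gtr0_norm _ 2)//.
  rewrite (@gtr0_norm _ d^-1) ?invr_gt0//.
  have di : 0 <= d^-1 * 2 by rewrite mulr_ge0// invr_ge0 ltW.
  apply: (@le_trans _ _ (4 * K ^+ 2 * (d^-1 * 2) * rho)).
    apply: ler_pM (ltW yrho); [exact: mulr_ge0|exact: enorm_ge0|].
    exact: ler_wpM2r.
  have -> : 4 * K ^+ 2 * (d^-1 * 2) * rho = cutoff_cst * (rho / d).
    by rewrite /cutoff_cst -/K; move: K => L; ring.
  apply: ler_wpM2l => //.
  rewrite ler_pdivrMr// mulrC ler_pdivlMr ?subr_gt0// /d subr_sqr mulrC.
  by rewrite ler_pM2l ?subr_gt0// lerDl ltW.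
Qed.

End cutoff.

(** * Square integrable functions and vector fields *)

Section real_lemmas.
Context {R : realType}.

(** Take t = - B / C; if C = 0, an affine function bounded below is constant. *)
Lemma discriminant_le (A B C : R) : 0 <= A -> 0 <= C ->
  (forall t, 0 <= A + 2 * t * B + t ^+ 2 * C) -> B ^+ 2 <= A * C.
Proof.
move=> A0 C0 h; have [C1|C1] := eqVneq C 0.
  have [->|B1] := eqVneq B 0; first by rewrite expr0n mulr_ge0.
  have := h (- (A + 1) / (2 * B)); rewrite C1 mulr0 addr0.
  have -> : A + 2 * (- (A + 1) / (2 * B)) * B = - 1 by field.
  by rewrite lerNr oppr0 ler10.
have C2 : 0 < C by rewrite lt_neqAle eq_sym C1.
have := h (- B / C).
have -> : A + 2 * (- B / C) * B + (- B / C) ^+ 2 * C = (A * C - B ^+ 2) / C by field.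
by rewrite pmulr_lge0 ?invr_gt0// subr_ge0.
Qed.

(** How the Cauchy-Schwarz inequality yields limits of products. *)
Lemma cvg_of_sqr_le (s e : nat -> R) (c K : R) :
  (forall j, (s j - c) ^+ 2 <= e j * K) -> e j @[j --> \oo] --> 0 ->
  s j @[j --> \oo] --> c.
Proof.
move=> h e0.
have eK : e j * K @[j --> \oo] --> 0 by rewrite -[X in _ --> X](mul0r K); exact: cvgMl.
apply/cvgrPdist_lt => eps eps0.
have /cvgr0_norm_lt/(_ _ (exprn_gt0 2 eps0)) := eK.
apply: filterS => j ej.
rewrite distrC -(@ltr_pXn2r _ 2)// ?nnegrE ?normr_ge0 ?(ltW eps0)//.
rewrite real_normK ?num_real//.
exact: le_lt_trans (h j) (le_lt_trans (ler_norm _) ej).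
Qed.

End real_lemmas.

Section L2_space.
Context {R : realType} {n : nat}.
Notation Rn := 'rV[R]_n.
Notation mu := (lebesgue_rV R n).
Variable U : set Rn.
Hypothesis mU : measurable U.
Implicit Types (f g h : Rn -> R) (F G H : Rn -> Rn).

Definition ip f g : R := \int[mu]_(y in U) (f y * g y).

Lemma L2_integrable f : L2 U f -> mu.-integrable U (EFin \o (fun y => f y ^+ 2)).
Proof.
move=> [mf fi]; apply/integrableP; split.
  by apply/measurable_EFinP; exact: measurable_funX.
by under eq_integral do rewrite /= ger0_norm ?sqr_ge0//.
Qed.

(** |f g| <= f^2 + g^2. *)
Lemma L2_mul f g : L2 U f -> L2 U g -> mu.-integrable U (EFin \o (fun y => f y * g y)).
Proof.
move=> Lf Lg; have [mf _] := Lf; have [mg _] := Lg.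
apply: (le_integrable mU _ _ (integrableD mU (L2_integrable Lf) (L2_integrable Lg))).
  by apply/measurable_EFinP; exact: measurable_funM.
move=> y _ /=; rewrite lee_fin (ger0_norm (addr_ge0 (sqr_ge0 _) (sqr_ge0 _))).
have := sqr_ge0 (f y - g y); have := sqr_ge0 (f y + g y).
have := sqr_ge0 (f y); have := sqr_ge0 (g y).
rewrite sqrrB sqrrD mulr2n ler_norml.
move: (f y ^+ 2) (g y ^+ 2) (f y * g y) => a b c h1 h2 h3 h4.
by apply/andP; split; lra.
Qed.

Lemma L2_of_integrable f : measurable_fun U f ->
  mu.-integrable U (EFin \o (fun y => f y ^+ 2)) -> L2 U f.
Proof.
move=> mf /integrableP[_ fi]; split=> //.
by under eq_integral do rewrite -[X in X%:E](ger0_norm (sqr_ge0 _)).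
Qed.

Lemma L2_le f g (M : R) : measurable_fun U f -> L2 U g ->
  (forall y, U y -> `|f y| <= M * `|g y|) -> L2 U f.
Proof.
move=> mf Lg fg; apply: L2_of_integrable => //.
have := integrableZl mU (M ^+ 2) (L2_integrable Lg).
apply: le_integrable => //.
  by apply/measurable_EFinP; exact: measurable_funX.
move=> y Uy /=; rewrite lee_fin (ger0_norm (sqr_ge0 _)).
rewrite (ger0_norm (mulr_ge0 (sqr_ge0 _) (sqr_ge0 _))) -exprMn.
rewrite -[leLHS]real_normK ?num_real// -[leRHS]real_normK ?num_real//.
have h := fg y Uy; rewrite ler_pXn2r// ?nnegrE//.
apply: le_trans h _; rewrite normrM ler_wpM2r//; exact: ler_norm.
Qed.

Lemma L2_mulb f g (M : R) : measurable_fun U f -> (forall y, U y -> `|f y| <= M) ->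
  L2 U g -> L2 U (fun y => f y * g y).
Proof.
move=> mf fM Lg; apply: (@L2_le _ g M) => //.
  by apply: measurable_funM => //; case: Lg.
by move=> y Uy; rewrite normrM ler_wpM2r// fM.
Qed.

Lemma L2_scaleD (a : R) f g : L2 U f -> L2 U g -> L2 U (fun y => a * f y + g y).
Proof.
move=> Lf Lg; have [mf _] := Lf; have [mg _] := Lg.
have i1 := integrableZl mU (a ^+ 2) (L2_integrable Lf).
have i2 := integrableZl mU (2 * a) (L2_mul Lf Lg).
have i := integrableD mU (integrableD mU i1 i2) (L2_integrable Lg).
apply: L2_of_integrable.
  by apply: measurable_funD => //; apply: measurable_funM.
by apply: eq_integrable i => // y _ /=; rewrite -!EFinM -!EFinD; congr EFin; ring.
Qed.

Lemma L2_cst0 : L2 U (fun=> 0).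
Proof.
split; first exact: measurable_cst.
by under eq_integral do rewrite expr0n; rewrite integral0.
Qed.

Lemma L2Z (a : R) f : L2 U f -> L2 U (fun y => a * f y).
Proof.
by move=> Lf; have := L2_scaleD a Lf L2_cst0; under eq_fun do rewrite addr0.
Qed.

Lemma L2B f g : L2 U f -> L2 U g -> L2 U (fun y => f y - g y).
Proof.
move=> Lf Lg; have := L2_scaleD (-1) Lg Lf.
by under eq_fun do rewrite mulN1r addrC.
Qed.

Lemma ipC f g : ip f g = ip g f.
Proof. by apply: eq_Rintegral => y _; rewrite mulrC. Qed.

Lemma ip_scaleDl (a : R) f g h : L2 U f -> L2 U g -> L2 U h ->
  ip (fun y => a * f y + g y) h = a * ip f h + ip g h.
Proof.
move=> Lf Lg Lh; rewrite /ip.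
under eq_Rintegral do rewrite mulrDl -mulrA.
rewrite RintegralD ?RintegralZl//; first exact: L2_mul.
  exact: (integrableZl mU a (L2_mul Lf Lh)).
exact: L2_mul.
Qed.

Lemma ip_ge0 f : 0 <= ip f f.
Proof. by apply: Rintegral_ge0 => y _; rewrite -expr2 sqr_ge0. Qed.

Lemma ip_CS f g : L2 U f -> L2 U g -> ip f g ^+ 2 <= ip f f * ip g g.
Proof.
move=> Lf Lg; apply: discriminant_le; [exact: ip_ge0..|] => t.
have L := L2_scaleD t Lg Lf.
have := ip_ge0 (fun y => t * g y + f y).
rewrite ip_scaleDl// [ip g (fun _ => _)]ipC [ip f (fun _ => _)]ipC.
rewrite !ip_scaleDl// (ipC g f) => h.
by apply: le_trans h _; rewrite le_eqVlt; apply/orP; left; apply/eqP; ring.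
Qed.

Lemma ip_cvg (f_ : nat -> Rn -> R) f g : (forall j, L2 U (f_ j)) -> L2 U f -> L2 U g ->
  \int[mu]_(y in U) ((f_ j y - f y) ^+ 2) @[j --> \oo] --> 0 ->
  ip (f_ j) g @[j --> \oo] --> ip f g.
Proof.
move=> Lf_ Lf Lg h; apply: (@cvg_of_sqr_le _ _ _ _ (ip g g) _ h) => j.
have -> : ip (f_ j) g - ip f g = ip (fun y => f_ j y - f y) g.
  rewrite -(mulN1r (ip f g)) addrC -ip_scaleDl//.
  by apply: eq_Rintegral => y _; rewrite mulN1r [- _ + _]addrC.
by apply: le_trans (ip_CS (L2B (Lf_ j) Lf) Lg) _.
Qed.

Definition vL2 F := forall i, L2 U (fun y => F y 0 i).

Definition vip F G : R := \int[mu]_(y in U) edot (F y) (G y).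

Lemma edot_integrable F G : vL2 F -> vL2 G ->
  mu.-integrable U (EFin \o (fun y => edot (F y) (G y))).
Proof.
move=> LF LG.
have := integrable_sum mU (index_enum 'I_n) (P := xpredT) (fun i _ => L2_mul (LF i) (LG i)).
by apply: eq_integrable => // y _ /=; rewrite sumEFin.
Qed.

Lemma vipC F G : vip F G = vip G F.
Proof. by apply: eq_Rintegral => y _; rewrite edotC. Qed.

Lemma vL2_scaleD (a : R) F G : vL2 F -> vL2 G -> vL2 (fun y => a *: F y + G y).
Proof.
move=> LF LG i; have := L2_scaleD a (LF i) (LG i).
by congr L2; apply/funext => y; rewrite !mxE.
Qed.

Lemma vL2B F G : vL2 F -> vL2 G -> vL2 (fun y => F y - G y).
Proof.
move=> LF LG i; have := L2B (LF i) (LG i).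
by congr L2; apply/funext => y; rewrite !mxE.
Qed.

Lemma vip_scaleDl (a : R) F G H : vL2 F -> vL2 G -> vL2 H ->
  vip (fun y => a *: F y + G y) H = a * vip F H + vip G H.
Proof.
move=> LF LG LH; rewrite /vip.
under eq_Rintegral do rewrite edotDl edotZl.
rewrite RintegralD ?RintegralZl//; first exact: edot_integrable.
  exact: (integrableZl mU a (edot_integrable LF LH)).
exact: edot_integrable.
Qed.

Lemma vip_ge0 F : 0 <= vip F F.
Proof. by apply: Rintegral_ge0 => y _; exact: edot_ge0. Qed.

Lemma vip_sqr (a : R) F G : vL2 F -> vL2 G ->
  vip (fun y => a *: F y + G y) (fun y => a *: F y + G y) =
  vip G G + 2 * a * vip F G + a ^+ 2 * vip F F.
Proof.
move=> LF LG; have L := vL2_scaleD a LF LG.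
rewrite vip_scaleDl// [vip F (fun _ => _)]vipC [vip G (fun _ => _)]vipC.
by rewrite !vip_scaleDl// (vipC G F); ring.
Qed.

Lemma vip_CS F G : vL2 F -> vL2 G -> vip F G ^+ 2 <= vip F F * vip G G.
Proof.
move=> LF LG; apply: discriminant_le; [exact: vip_ge0..|] => t.
by rewrite (vipC F) -vip_sqr//; exact: vip_ge0.
Qed.

(** By the Cauchy-Schwarz inequality, products do not distinguish vector fields
    at distance 0. *)
Lemma vip_diff_eq0 F G H : vL2 F -> vL2 G -> vL2 H ->
  vip (fun y => F y - G y) (fun y => F y - G y) = 0 -> vip F H = vip G H.
Proof.
move=> LF LG LH FG0; have := vip_CS (vL2B LF LG) LH.
rewrite FG0 mul0r => h; have /eqP : vip (fun y => F y - G y) H == 0.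
  by rewrite -sqrf_eq0 eq_le h sqr_ge0.
have -> : vip (fun y => F y - G y) H = vip F H - vip G H.
  rewrite -(mulN1r (vip G H)) addrC -vip_scaleDl//.
  by apply: eq_Rintegral => y _; rewrite scaleN1r [- _ + _]addrC.
by move/eqP; rewrite subr_eq0 => /eqP.
Qed.

Lemma ip_le_vip F i : vL2 F -> ip (fun y => F y 0 i) (fun y => F y 0 i) <= vip F F.
Proof.
move=> LF; apply: le_Rintegral => //; [exact: L2_mul|exact: edot_integrable|].
by move=> y _; rewrite -expr2; exact: sqr_coord_le.
Qed.

End L2_space.

(** * Integration by parts against test functions *)

Section integration_by_parts.
Context {R : realType} {n : nat}.
Notation Rn := 'rV[R]_n.
Notation mu := (lebesgue_rV R n).
Implicit Types (f g phi psi eta : Rn -> R) (U V K B : set Rn).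

Lemma compact_sub_box K : compact K -> exists2 N : R, 0 < N & K `<=` box 0 N.
Proof.
move=> cK.
have [M [_ M1]] : bounded_set ((fun y : Rn => edot (y - 0) (y - 0)) @` K).
  apply: compact_bounded; apply: continuous_compact => //.
  by apply: continuous_subspaceT; exact/smooth_continuous/smooth_edot.
have N1 : 1 < `|M| + 2 by rewrite (@lt_le_trans _ _ 2) ?ltr1n ?lerDr.
exists (`|M| + 2); first exact: lt_trans N1.
move=> y Ky; apply: eball_sub_box; rewrite /eball/= enorm_lt ?(ltW (lt_trans ltr01 N1))//.
have h : `|edot (y - 0) (y - 0)| <= `|M| + 1.
  by apply: (M1 (`|M| + 1)); [rewrite (le_lt_trans (ler_norm _))// ltrDl|exists y].
apply: le_lt_trans (le_trans (ler_norm _) h) _.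
rewrite expr2; apply: (@lt_le_trans _ _ (`|M| + 2)); first by rewrite ltrD2l ltr1n.
by rewrite ler_pMr ?ltW// (lt_trans ltr01).
Qed.

Lemma box_finite (a : Rn) (e : R) : 0 <= e -> (mu (box a e) < +oo)%E.
Proof. by move=> e0; rewrite lebesgue_rV_box// ltry. Qed.

Lemma L2_indic U B : measurable U -> measurable B -> (mu B < +oo)%E -> L2 U (\1_B : Rn -> R).
Proof.
move=> mU mB muB; split; first exact: measurable_indic.
under eq_integral.
  move=> y _; rewrite (_ : (\1_B y) ^+ 2 = \1_B y); last first.
    by rewrite indicE; case: (_ \in _); rewrite ?expr1n ?expr0n.
  over.
rewrite integral_indic//; apply: le_lt_trans muB.
by apply: le_measure; rewrite ?inE//; exact: measurableI.
Qed.

Lemma test_box U phi : test_function U phi ->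
  exists2 N : R, 0 < N & forall y, phi y != 0 -> box 0 N y.
Proof.
move=> [_ /compact_sub_box[N N0 KN] _]; exists N => // y fy.
by apply: KN; exact: subset_closure.
Qed.

Lemma test_L2 U V phi : measurable U -> test_function V phi -> L2 U phi.
Proof.
move=> mU tphi; have [M M0 phiM] := test_bounded tphi.
have [N N0 phiN] := test_box tphi.
have L := L2_indic mU (measurable_box (0 : Rn) N) (box_finite 0 (ltW N0)).
apply: (@L2_le _ _ _ mU _ _ M _ L).
  by apply: continuous_measurable_rV; apply: smooth_continuous; exact: test_smooth tphi.
move=> y _; have [->|/phiN yN] := eqVneq (phi y) 0; first by rewrite normr0 mulr_ge0// ltW.
by rewrite indicE mem_set// normr1 mulr1.
Qed.

Lemma test_integrable U V phi : measurable U -> test_function V phi ->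
  mu.-integrable U (EFin \o phi).
Proof.
move=> mU tphi; have [N N0 phiN] := test_box tphi.
have L := L2_indic mU (measurable_box (0 : Rn) N) (box_finite 0 (ltW N0)).
have := L2_mul mU (test_L2 mU tphi) L.
apply: eq_integrable => // y _ /=; congr EFin.
have [->|/phiN yN] := eqVneq (phi y) 0; first by rewrite mul0r.
by rewrite indicE mem_set// mulr1.
Qed.

Lemma derive_line f (y v : Rn) (s : R) :
  (derivable (fun t : R => f (y + t *: v)) s 1 <-> derivable f (y + s *: v) v) /\
  'D_1 (fun t : R => f (y + t *: v)) s = 'D_v f (y + s *: v).
Proof.
rewrite /derivable /derive; set g1 := fun h => h^-1 *: _; set g2 := fun h => h^-1 *: _.
suff -> : g1 = g2 by [].
rewrite funeqE /g1 /g2 => t /=; congr (_ *: (f _ - _)).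
by rewrite [_%:A]mulr1 scalerDl addrCA.
Qed.

(** By translation invariance the integral of eta (y + s e_i) does not depend on
    s; differentiate it under the integral sign at s = 0. *)
Lemma integral_partial_test eta i : test_function setT eta ->
  \int[mu]_y partial i eta y = 0.
Proof.
move=> teta; have seta := test_smooth teta.
have [M M0 etaM] := test_bounded (test_partial i teta).
have [N N0 etaN] := test_box (test_partial i teta).
pose e : Rn := delta_mx 0 i.
pose f (s : R) (y : Rn) : R := eta (y + s *: e).
(* for |s| < 1, y + s e is in the box of size N only if y is in that of size N + 1 *)
pose G (y : Rn) : R := M * \1_(box 0 (N + 1)) y.
have N10 : 0 <= N + 1 by rewrite addr_ge0// ltW.
have mB := measurable_box (0 : Rn) (N + 1).
have fE s : \int[mu]_(y in setT) f s y = \int[mu]_(y in setT) eta y.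
  have me : measurable_fun setT eta.
    by apply: continuous_measurable_rV; exact: smooth_continuous.
  by rewrite -(Rintegral_shift (s *: e) measurableT me) preimage_setT.
have := @differentiation_under_integral R _ _ mu f setT measurableT 0 (-1) 1.
move=> /(_ _ _ _ G) H.
have {H} : derive1 (fun s : R => \int[mu]_(y in setT) f s y) 0 =
    \int[mu]_(y in setT) partial1of2 f ^~ y 0.
  apply: H.
  - by rewrite /= in_itv/= ltr01 ltrN10.
  - move=> s _; apply: (test_integrable (V := (fun y : Rn => y + s *: e) @^-1` setT)) => //.
    exact: test_shift.
  - by move=> s y _ _; apply/(derive_line eta y e s).1; exact: smooth_derivable.
  - by move=> y; rewrite /G mulr_ge0 ?(ltW M0)// indicE.
  - have LB := L2_indic measurableT mB (box_finite 0 N10).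
    have := L2_mul measurableT (L2Z measurableT M LB) LB.
    apply: eq_integrable => // y _ /=; congr EFin; rewrite /G indicE.
    by case: (_ \in _); rewrite ?mulr1 ?mulr0.
  - move=> s y; rewrite /= in_itv/= => /andP[s1 s2] _.
    rewrite partial1of2E (derive_line eta y e s).2.
    have [h|/etaN yN] := eqVneq (partial i eta (y + s *: e)) 0.
      by rewrite -/(partial i eta _) h normr0 /G mulr_ge0 ?(ltW M0)// indicE.
    rewrite /G indicE mem_set ?mulr1; first exact: etaM.
    move=> j; have := yN j; rewrite !mxE eqxx /= !subr0 => h.
    have h1 : `|s * (j == i)%:R| <= 1.
      by rewrite normrM; case: eqP => _; rewrite ?normr1 ?normr0 ?mulr1 ?mulr0// ler_norml !ltW.
    rewrite -(addrK (s * (j == i)%:R) (y 0 j)).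
    by apply: le_lt_trans (ler_normB _ _) _; rewrite ltr_leD.
under [X in derive1 X _]eq_fun do rewrite fE.
rewrite derive1_cst => h; rewrite [RHS]h; apply: eq_Rintegral => y _.
by rewrite partial1of2E (derive_line eta y e 0).2 scale0r addr0.
Qed.

(** Both sides are integrals over the whole space of the same function, extended
    by 0. *)
Lemma Rintegral_restrict U V f : (forall y, ~ (U y /\ V y) -> f y = 0) ->
  \int[mu]_(y in U) f y = \int[mu]_(y in V) f y.
Proof.
move=> f0; rewrite Rintegral_mkcond [RHS]Rintegral_mkcond; congr (Rintegral _ _ _).
apply/funext => y; rewrite !patchE.
have [Uy|Uy] := pselect (U y); have [Vy|Vy] := pselect (V y).
- by rewrite !mem_set.
- by rewrite (mem_set Uy) (memNset Vy); apply: f0 => -[].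
- by rewrite (memNset Uy) (mem_set Vy); apply/esym/f0 => -[].
- by rewrite !memNset.
Qed.

Lemma integral_partial_test_in U eta i : test_function U eta ->
  \int[mu]_(y in U) partial i eta y = 0.
Proof.
move=> teta; rewrite -(integral_partial_test i (eta := eta)).
  by apply: Rintegral_restrict => y Uy; apply: (test_out (test_partial i teta)) => ?; exact: Uy.
exact: test_sub teta _.
Qed.

(** The derivative of the product of two test functions has integral 0. *)
Lemma test_weak_gradient U phi : measurable U -> test_function U phi ->
  weak_gradient U phi (grad phi).
Proof.
move=> mU tphi psi tpsi i.
have sphi := test_smooth tphi; have spsi := test_smooth tpsi.
have t1 := test_mull sphi (test_partial i tpsi).
have t2 := test_mulr (test_partial i tphi) spsi.
have := integral_partial_test_in i (test_mull sphi tpsi).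
rewrite partialM// RintegralD ?(test_integrable mU t1) ?(test_integrable mU t2)//.
move=> /eqP; rewrite addr_eq0 => /eqP ->; congr (- _).
by apply: eq_Rintegral => y _; rewrite mxE.
Qed.

End integration_by_parts.

Lemma cvg0_lin {R : realType} (a b : R) (s t : nat -> R) :
  s j @[j --> \oo] --> 0 -> t j @[j --> \oo] --> 0 ->
  a * s j + b * t j @[j --> \oo] --> 0.
Proof.
move=> s0 t0; rewrite -[X in _ --> X](addr0 0).
rewrite -[X in _ --> X + _](mulr0 a) -[X in _ --> _ + X](mulr0 b).
by apply: cvgD; apply: cvgM => //; exact: cvg_cst.
Qed.

Section vip_more.
Context {R : realType} {n : nat}.
Notation Rn := 'rV[R]_n.
Notation mu := (lebesgue_rV R n).
Variable U : set Rn.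
Hypothesis mU : measurable U.
Implicit Types (f g h : Rn -> R) (F G H : Rn -> Rn).

Lemma vip_sum F G : vL2 U F -> vL2 U G ->
  vip U F G = \sum_(i < n) ip U (fun y => F y 0 i) (fun y => G y 0 i).
Proof.
move=> LF LG; rewrite /vip /edot /ip.
have L i := L2_mul mU (LF i) (LG i).
elim: (index_enum _) => [|i s IH].
  rewrite big_nil; under eq_Rintegral do rewrite big_nil.
  by rewrite /Rintegral integral0.
rewrite big_cons -IH -RintegralD//; last first.
  apply: eq_integrable (integrable_sum mU s (P := xpredT) (fun i _ => L i)) => //.
  by move=> y _ /=; rewrite sumEFin.
by apply: eq_Rintegral => y _; rewrite big_cons.
Qed.

Lemma vip_Bl F G H : vL2 U F -> vL2 U G -> vL2 U H ->
  vip U (fun y => F y - G y) H = vip U F H - vip U G H.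
Proof.
move=> LF LG LH; rewrite -(mulN1r (vip U G H)) addrC -vip_scaleDl//.
by apply: eq_Rintegral => y _; rewrite scaleN1r [- _ + _]addrC.
Qed.

Lemma ip_Bl f g h : L2 U f -> L2 U g -> L2 U h ->
  ip U (fun y => f y - g y) h = ip U f h - ip U g h.
Proof.
move=> Lf Lg Lh; rewrite -(mulN1r (ip U g h)) addrC -ip_scaleDl//.
by apply: eq_Rintegral => y _; rewrite mulN1r [- _ + _]addrC.
Qed.

Lemma vip_cvg (F_ : nat -> Rn -> Rn) F G : (forall j, vL2 U (F_ j)) -> vL2 U F -> vL2 U G ->
  \int[mu]_(y in U) edot (F_ j y - F y) (F_ j y - F y) @[j --> \oo] --> 0 ->
  vip U (F_ j) G @[j --> \oo] --> vip U F G.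
Proof.
move=> LF_ LF LG h; apply: (@cvg_of_sqr_le _ _ _ _ (vip U G G) _ h) => j.
rewrite -vip_Bl//; exact: (vip_CS mU (vL2B mU (LF_ j) LF) LG).
Qed.

Lemma cvg0_squeeze (s e : nat -> R) : (forall j, 0 <= s j <= e j) ->
  e j @[j --> \oo] --> 0 -> s j @[j --> \oo] --> 0.
Proof.
by move=> se e0; apply: (squeeze_cvgr _ (cvg_cst 0) e0); apply: nearW.
Qed.

Lemma le_ip f g : measurable_fun U f -> L2 U g ->
  (forall y, U y -> f y ^+ 2 <= g y ^+ 2) -> ip U f f <= ip U g g.
Proof.
move=> mf Lg fg; apply: le_Rintegral => //; try exact: L2_mul.
have Lf : L2 U f.
  apply: (@L2_le _ _ _ mU _ _ 1 mf Lg) => y /fg; rewrite mul1r.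
  by rewrite -[leLHS]real_normK ?num_real// -[leRHS]real_normK ?num_real// ler_pXn2r// nnegrE.
exact: L2_mul.
Qed.

Lemma ip_sqr (a : R) f g : L2 U f -> L2 U g ->
  ip U (fun y => a * f y + g y) (fun y => a * f y + g y) =
  ip U g g + 2 * a * ip U f g + a ^+ 2 * ip U f f.
Proof.
move=> Lf Lg; have L1 := L2_scaleD mU a Lf Lg.
rewrite ip_scaleDl// [ip U f (fun _ => _)]ipC [ip U g (fun _ => _)]ipC.
by rewrite !ip_scaleDl// (ipC U g f); ring.
Qed.

(** Parallelogram identity: the expansions for a and - a add up to the
    right-hand side. *)
Lemma ip_scaleD_le (a : R) f g : L2 U f -> L2 U g ->
  ip U (fun y => a * f y + g y) (fun y => a * f y + g y) <=
  2 * a ^+ 2 * ip U f f + 2 * ip U g g.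
Proof.
move=> Lf Lg; have := ip_ge0 U (fun y => - a * f y + g y).
rewrite !ip_sqr// sqrrN => h; rewrite -subr_ge0; apply: le_trans h _.
by rewrite le_eqVlt; apply/orP; left; apply/eqP; ring.
Qed.

Lemma vip_scaleD_le (a : R) F G : vL2 U F -> vL2 U G ->
  vip U (fun y => a *: F y + G y) (fun y => a *: F y + G y) <=
  2 * a ^+ 2 * vip U F F + 2 * vip U G G.
Proof.
move=> LF LG; have := vip_ge0 U (fun y => - a *: F y + G y).
rewrite !vip_sqr// sqrrN => h; rewrite -subr_ge0; apply: le_trans h _.
by rewrite le_eqVlt; apply/orP; left; apply/eqP; ring.
Qed.

End vip_more.

(** * Gradients of functions of the Sobolev space *)

Section H10_theory.
Context {R : realType} {n : nat}.
Notation Rn := 'rV[R]_n.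
Notation mu := (lebesgue_rV R n).
Implicit Types (U V : set Rn) (f g h v w phi psi : Rn -> R) (F G H : Rn -> Rn).

Lemma grad_coord phi i : (fun y => grad phi y 0 i) = partial i phi.
Proof. by apply/funext => y; rewrite mxE. Qed.

Lemma test_grad_L2 U V phi : measurable U -> test_function V phi -> vL2 U (grad phi).
Proof. by move=> mU tphi i; rewrite grad_coord; exact: test_L2 (test_partial i tphi). Qed.

Lemma grad_scaleD (a : R) phi psi : smooth phi -> smooth psi ->
  grad (fun y => a * phi y + psi y) = fun y => a *: grad phi y + grad psi y.
Proof.
move=> sphi spsi; apply/funext => y; apply/rowP => i; rewrite !mxE.
have sa := smoothM (smooth_cst a) sphi.
have -> := congr1 (fun f : Rn -> R => f y) (partialD i sa spsi).
have -> := congr1 (fun f : Rn -> R => f y) (partialM i (smooth_cst a) sphi).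
by rewrite partial_cst mul0r addr0.
Qed.

(** Let D be the difference of the gradients, phi_j and phi'_j the two
    approximating sequences. The partial derivatives of phi_j - phi'_j are
    themselves test functions, so their products with D vanish; since they tend
    to D in L^2, so does the square norm of D. *)
Lemma H10_gradient_uniq U v v' G G' : measurable U ->
  H10_gradient U v G -> H10_gradient U v' G' -> (forall y, U y -> v y = v' y) ->
  vip U (fun y => G y - G' y) (fun y => G y - G' y) = 0.
Proof.
move=> mU [Lv LG wG [phi [tphi _ phiG]]] [_ LG' wG' [phi' [tphi' _ phiG']]] vv'.
have LD := vL2B mU LG LG'.
set D := fun y => G y - G' y in LD *.
have LP j : vL2 U (grad (phi j)) by exact: test_grad_L2.
have LP' j : vL2 U (grad (phi' j)) by exact: test_grad_L2.
have D0 psi i : test_function U psi -> ip U (fun y => D y 0 i) psi = 0.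
  move=> tpsi; have Lpsi := test_L2 mU tpsi.
  transitivity (ip U (fun y => G y 0 i) psi - ip U (fun y => G' y 0 i) psi).
    by rewrite -ip_Bl//; apply: eq_Rintegral => y _; rewrite !mxE.
  apply/eqP; rewrite subr_eq0 -eqr_opp; apply/eqP.
  rewrite -(wG _ tpsi i) -(wG' _ tpsi i); apply: eq_Rintegral => y.
  by rewrite inE => Uy; rewrite vv'.
have gD j : vip U (grad (phi j)) D = 0.
  rewrite vipC vip_sum// big1// => i _; rewrite grad_coord; apply: D0.
  exact: test_partial.
have gD' j : vip U (grad (phi' j)) D = 0.
  rewrite vipC vip_sum// big1// => i _; rewrite grad_coord; apply: D0.
  exact: test_partial.
have lim0 P (k : R) : (forall j : nat, P j = 0) -> P j @[j --> \oo] --> k -> k = 0.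
  move=> /funext ->; move/cvg_lim => <-//; exact: lim_cst.
rewrite vip_Bl// (lim0 _ _ gD (vip_cvg mU LP LG LD phiG)).
by rewrite (lim0 _ _ gD' (vip_cvg mU LP' LG' LD phiG')) subrr.
Qed.

Lemma H10_gradient_lin U (a : R) v w G H : measurable U ->
  H10_gradient U v G -> H10_gradient U w H ->
  H10_gradient U (fun y => a * v y + w y) (fun y => a *: G y + H y).
Proof.
move=> mU [Lv LG wG [phi [tphi phiv phiG]]] [Lw LH wH [psi [tpsi psiw psiH]]].
have L1 j := test_L2 mU (tphi j); have L2 j := test_L2 mU (tpsi j).
have P1 j := test_grad_L2 mU (tphi j); have P2 j := test_grad_L2 mU (tpsi j).
split; [exact: L2_scaleD|exact: (vL2_scaleD mU)| |].
- move=> eta teta i; have e1 := test_L2 mU teta; have e2 := test_L2 mU (test_partial i teta).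
  have h1 := wG _ teta i; have h2 := wH _ teta i.
  transitivity (a * ip U v (partial i eta) + ip U w (partial i eta)).
    by rewrite -ip_scaleDl.
  rewrite [ip U v _]h1 [ip U w _]h2 mulrN -opprD; congr (- _).
  transitivity (a * ip U (fun y => G y 0 i) eta + ip U (fun y => H y 0 i) eta) => //.
  by rewrite -ip_scaleDl//; apply: eq_Rintegral => y _; rewrite !mxE.
- exists (fun j y => a * phi j y + psi j y); split.
  + by move=> j; exact: test_scaleD.
  + apply: (@cvg0_squeeze _ _ (fun j =>
        2 * a ^+ 2 * ip U (fun y => phi j y - v y) (fun y => phi j y - v y) +
        2 * ip U (fun y => psi j y - w y) (fun y => psi j y - w y))).
      move=> j; apply/andP; split; first by apply: Rintegral_ge0 => y _; exact: sqr_ge0.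
      apply: le_trans (ip_scaleD_le mU a (L2B mU (L1 j) Lv) (L2B mU (L2 j) Lw)).
      rewrite le_eqVlt; apply/orP; left; apply/eqP; apply: eq_Rintegral => y _.
      by rewrite -expr2; congr (_ ^+ 2); ring.
    by apply: cvg0_lin; [exact: phiv|exact: psiw].
  + apply: (@cvg0_squeeze _ _ (fun j =>
        2 * a ^+ 2 * vip U (fun y => grad (phi j) y - G y) (fun y => grad (phi j) y - G y) +
        2 * vip U (fun y => grad (psi j) y - H y) (fun y => grad (psi j) y - H y))).
      move=> j; apply/andP; split; first by apply: Rintegral_ge0 => y _; exact: edot_ge0.
      apply: le_trans (vip_scaleD_le mU a (vL2B mU (P1 j) LG) (vL2B mU (P2 j) LH)).
      rewrite le_eqVlt; apply/orP; left; apply/eqP; apply: eq_Rintegral => y _.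
      rewrite (grad_scaleD a (test_smooth (tphi j)) (test_smooth (tpsi j))).
      suff -> : a *: grad (phi j) y + grad (psi j) y - (a *: G y + H y) =
        a *: (grad (phi j) y - G y) + (grad (psi j) y - H y) by [].
      by rewrite scalerBr opprD addrACA.
    by apply: cvg0_lin; [exact: phiG|exact: psiH].
Qed.

Lemma test_H10 U phi : measurable U -> test_function U phi -> H10_gradient U phi (grad phi).
Proof.
move=> mU tphi; split; [exact: test_L2 tphi|exact: test_grad_L2 tphi|exact: test_weak_gradient|].
exists (fun=> phi); split=> //.
  rewrite (_ : Rintegral _ _ _ = 0); first exact: cvg_cst.
  by under eq_Rintegral do rewrite subrr expr0n; rewrite /Rintegral integral0.
rewrite (_ : Rintegral _ _ _ = 0); first exact: cvg_cst.
by under eq_Rintegral do rewrite subrr edot0l; rewrite /Rintegral integral0.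
Qed.

Lemma H10_gradient0 U : measurable U -> H10_gradient U (fun=> 0) (fun=> 0).
Proof.
move=> mU; have := test_H10 mU (@test0 _ _ U); congr H10_gradient.
by apply/funext => y; apply/rowP => i; rewrite !mxE partial_cst.
Qed.

Definition dirichlet U v w : R := vip U (wgrad U v) (wgrad U w).

Lemma wgradP U v : H10 U v -> H10_gradient U v (wgrad U v).
Proof. by move=> vU; exact: (getPex vU). Qed.

(** The form is defined with the gradients chosen by [wgrad]; by uniqueness it
    can be computed with explicit ones. *)
Lemma dirichletE U v w G H : measurable U -> H10_gradient U v G -> H10_gradient U w H ->
  dirichlet U v w = vip U G H.
Proof.
move=> mU vG wH.
have vW := wgradP (ex_intro _ _ vG); have wW := wgradP (ex_intro _ _ wH).
have [_ LV _ _] := vW; have [_ LW _ _] := wW.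
have [_ LG _ _] := vG; have [_ LH _ _] := wH.
rewrite /dirichlet (vip_diff_eq0 mU LV LG LW); last exact: (H10_gradient_uniq mU vW vG).
rewrite vipC (vip_diff_eq0 mU LW LH LG); last exact: (H10_gradient_uniq mU wW wH).
exact: vipC.
Qed.

End H10_theory.

(** * Poincare inequality, cutoffs and translations *)

Section H10_tools.
Context {R : realType} {n : nat}.
Notation Rn := 'rV[R]_n.
Notation mu := (lebesgue_rV R n).
Implicit Types (U V : set Rn) (f g h u v w phi psi : Rn -> R) (F G H : Rn -> Rn).

(** Test the weak gradient against y_i phi_j, where phi_j tends to v. Since the
    i-th derivative of y_i phi_j is phi_j + y_i d_i phi_j, the limit says that
    the integral of v^2 is - 2 times that of y_i v G_i, and the Cauchy-Schwarz
    inequality concludes. *)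
Lemma poincare U (i : 'I_n) (a : R) v G : measurable U ->
  (forall y, U y -> `|y 0 i| <= a) -> H10_gradient U v G ->
  ip U v v <= 4 * a ^+ 2 * ip U (fun y => G y 0 i) (fun y => G y 0 i).
Proof.
move=> mU Ua [Lv LG wG [phi [tphi phiv phiG]]].
pose X (y : Rn) := y 0 i.
have sX : smooth X by exact: smooth_coord.
have mX (D : set Rn) : measurable_fun D X.
  by apply: continuous_measurable_rV; exact: smooth_continuous.
have LX f : L2 U f -> L2 U (fun y => X y * f y) by apply: (L2_mulb mU (mX _) Ua).
have LP j := test_L2 mU (tphi j); have LdP j := test_L2 mU (test_partial i (tphi j)).
pose g y := G y 0 i.
have E j : ip U (partial i (phi j)) (fun y => X y * v y) + ip U (phi j) v +
    ip U (phi j) (fun y => X y * g y) = 0.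
  have := wG _ (test_mull sX (tphi j)) i.
  have -> : partial i (fun y => X y * phi j y) = fun y => X y * partial i (phi j) y + phi j y.
    rewrite partialM//; last exact: test_smooth (tphi j).
    by apply/funext => y; rewrite partial_coord eqxx mul1r.
  move=> h; have : ip U v (fun y => X y * partial i (phi j) y + phi j y) =
      - ip U (phi j) (fun y => X y * g y).
    by rewrite [LHS]h; congr (- _); apply: eq_Rintegral => y _; rewrite /g; ring.
  move=> e; apply/eqP; rewrite -[X in _ + X]opprK -e subr_eq0; apply/eqP.
  rewrite /ip -RintegralD//; [|exact: L2_mul (LX _ Lv)|exact: L2_mul].
  by apply: eq_Rintegral => y _; ring.
have c1 : ip U (partial i (phi j)) (fun y => X y * v y) @[j --> \oo] -->
    ip U g (fun y => X y * v y).
  apply: (ip_cvg mU LdP (LG i) (LX _ Lv)).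
  apply: (cvg0_squeeze _ phiG) => j; apply/andP; split.
    by apply: Rintegral_ge0 => y _; exact: sqr_ge0.
  have := ip_le_vip mU i (vL2B mU (test_grad_L2 mU (tphi j)) LG).
  apply: le_trans; rewrite le_eqVlt; apply/orP; left; apply/eqP.
  by apply: eq_Rintegral => y _; rewrite !mxE expr2.
have c2 := ip_cvg mU LP Lv Lv phiv.
have c3 := ip_cvg mU LP Lv (LX _ (LG i)) phiv.
have e0 : ip U g (fun y => X y * v y) + ip U v v + ip U v (fun y => X y * g y) = 0.
  have h : ip U (partial i (phi j)) (fun y => X y * v y) + ip U (phi j) v
      + ip U (phi j) (fun y => X y * g y) @[j --> \oo] -->
      ip U g (fun y => X y * v y) + ip U v v + ip U v (fun y => X y * g y).
    by apply: cvgD => //; exact: cvgD.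
  by rewrite (funext E) in h; move/cvg_lim : h => <-//; exact: lim_cst.
have e1 : ip U g (fun y => X y * v y) = ip U v (fun y => X y * g y).
  by apply: eq_Rintegral => y _; ring.
rewrite e1 in e0.
have Xg : ip U (fun y => X y * g y) (fun y => X y * g y) <= a ^+ 2 * ip U g g.
  rewrite /ip -RintegralZl//; last exact: (L2_mul mU (LG i) (LG i)).
  apply: le_Rintegral => //; [exact: (L2_mul mU (LX _ (LG i)) (LX _ (LG i)))| |].
    exact: (integrableZl mU (a ^+ 2) (L2_mul mU (LG i) (LG i))).
  move=> y Uy; rewrite -!expr2 exprMn; apply: ler_wpM2r; first exact: sqr_ge0.
  have h := Ua y Uy; rewrite -[leLHS]real_normK ?num_real// ler_pXn2r// nnegrE//.
  exact: le_trans h.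
have CS := ip_CS mU Lv (LX _ (LG i)).
have v0 := ip_ge0 U v.
have [->|vn0] := eqVneq (ip U v v) 0.
  apply: mulr_ge0; last exact: ip_ge0.
  by apply: mulr_ge0 => //; exact: sqr_ge0.
have vp : 0 < ip U v v by rewrite lt_neqAle eq_sym vn0.
rewrite -(ler_pM2l vp).
apply: (@le_trans _ _ (4 * (ip U v v * ip U (fun y => X y * g y) (fun y => X y * g y)))).
  apply: (@le_trans _ _ (4 * ip U v (fun y => X y * g y) ^+ 2)); last by rewrite ler_wpM2l.
  rewrite le_eqVlt; apply/orP; left; apply/eqP.
  have -> : ip U v v = - 2 * ip U v (fun y => X y * g y) by lra.
  by ring.
rewrite [leRHS](_ : _ = 4 * (ip U v v * (a ^+ 2 * ip U g g))); last by rewrite -/g; ring.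
by apply: ler_wpM2l => //; exact: ler_wpM2l.
Qed.

Lemma L2_supp U V f : measurable U -> measurable V ->
  (forall y, ~ (U y /\ V y) -> f y = 0) -> L2 V f -> L2 U f.
Proof.
move=> mU mV f0 [mf fi]; split.
  have : measurable_fun (U `&` V) f by apply: measurable_funS mf => //; exact: subIsetr.
  move/(measurable_restrict f mV mU); congr measurable_fun; apply/funext => y.
  rewrite patchE; case: ifPn => //; rewrite notin_setE => Vy; apply/esym/f0; tauto.
suff <- : (\int[mu]_(y in V) (f y ^+ 2)%:E = \int[mu]_(y in U) (f y ^+ 2)%:E)%E by [].
rewrite integral_mkcond [RHS]integral_mkcond; congr (integral _ _ _); apply/funext => y.
rewrite !patchE.
have [Uy|Uy] := pselect (U y); have [Vy|Vy] := pselect (V y).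
- by rewrite !mem_set.
- by rewrite (mem_set Uy) (memNset Vy) f0 ?expr0n//; tauto.
- by rewrite (memNset Uy) (mem_set Vy) f0 ?expr0n//; tauto.
- by rewrite !memNset.
Qed.

(** If psi is a test function in U, then phi psi is one in V, so the weak
    gradient of phi u is obtained from that of u; and the products of phi with
    the test functions that approximate u approximate phi u. All integrands
    vanish outside the intersection of U and V, which allows to pass from one
    domain to the other. *)
Lemma H10_cutoff U V phi u G : measurable U -> measurable V ->
  test_function U phi -> test_function V phi -> H10_gradient V u G ->
  H10_gradient U (fun y => phi y * u y) (fun y => phi y *: G y + u y *: grad phi y).
Proof.
move=> mU mV tU tV [Lu LG wG [p [tp pu pG]]].
have sphi := test_smooth tU.
have [M M0 phiM] := test_bounded tU.
have mphi (D : set Rn) : measurable_fun D phi.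
  by apply: continuous_measurable_rV; exact: smooth_continuous.
have mdphi i (D : set Rn) : measurable_fun D (partial i phi).
  by apply: continuous_measurable_rV; apply: smooth_continuous; exact: smooth_partial.
have out y : ~ (U y /\ V y) -> phi y = 0.
  move=> UV; have [Uy|] := pselect (U y); last exact: test_out.
  by apply: (test_out tV) => Vy; exact: UV.
have dout i y : ~ (U y /\ V y) -> partial i phi y = 0.
  move=> UV; have [Uy|] := pselect (U y); last exact: (test_out (test_partial i tU)).
  by apply: (test_out (test_partial i tV)) => Vy; exact: UV.
have gout y : ~ (U y /\ V y) -> grad phi y = 0.
  by move=> UV; apply/rowP => i; rewrite !mxE; exact: dout.
have Lpu f : L2 V f -> L2 V (fun y => phi y * f y).
  by apply: (L2_mulb mV (mphi _) (fun y _ => phiM y)).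
have Ldu i f : L2 V f -> L2 V (fun y => partial i phi y * f y).
  have [N _ phiN] := test_bounded (test_partial i tU).
  by apply: (L2_mulb mV (mdphi _ _) (fun y _ => phiN y)).
have LpG F : vL2 V F -> vL2 V (fun y => phi y *: F y).
  by move=> LF i; have := Lpu _ (LF i); congr L2; apply/funext => y; rewrite mxE.
have Lug f : L2 V f -> vL2 V (fun y => f y *: grad phi y).
  by move=> Lf i; have := Ldu i _ Lf; congr L2; apply/funext => y; rewrite !mxE mulrC.
split.
- by apply: (L2_supp mU mV) (Lpu _ Lu) => y /out ->; rewrite mul0r.
- move=> i; apply: (L2_supp mU mV).
    by move=> y UV; rewrite (out _ UV) (gout _ UV) scale0r scaler0 addr0 mxE.
  have := vL2_scaleD mV 1 (LpG _ LG) (Lug _ Lu) i.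
  by congr L2; apply/funext => y; rewrite scale1r.
- move=> psi tpsi i.
  have spsi := test_smooth tpsi; have dpsi := smooth_partial i spsi.
  have tpp := test_mulr tV spsi.
  have Lphi := test_L2 mV tV; have Ldphi := test_L2 mV (test_partial i tV).
  have [N _ psiN] := test_bounded tpsi.
  have L1 := test_L2 mV (test_mulr tV dpsi).
  have L2' := test_L2 mV (test_mulr (test_partial i tV) spsi).
  have h := wG _ tpp i.
  have h2 : ip V u (partial i (fun y => phi y * psi y)) =
     ip V u (fun y => phi y * partial i psi y) + ip V u (fun y => partial i phi y * psi y).
    rewrite (partialM i sphi spsi) /ip -RintegralD//; try exact: L2_mul.
    by apply: eq_Rintegral => y _; rewrite mulrDr.
  rewrite (@Rintegral_restrict _ _ _ V); last by move=> y /out ->; rewrite !mul0r.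
  rewrite [in RHS](@Rintegral_restrict _ _ _ V); last first.
    by move=> y UV; rewrite (out _ UV) (gout _ UV) scale0r scaler0 addr0 mxE mul0r.
  transitivity (ip V u (fun y => phi y * partial i psi y)).
    by apply: eq_Rintegral => y _; ring.
  have -> : ip V u (fun y => phi y * partial i psi y) =
      - (ip V (fun y => G y 0 i) (fun y => phi y * psi y) +
         ip V u (fun y => partial i phi y * psi y)).
    by rewrite opprD -[X in _ = X + _]h -/(ip V u _) h2 addrK.
  congr (- _); rewrite /ip -RintegralD//; [|exact: L2_mul (LG i) (test_L2 mV tpp)|exact: L2_mul].
  by apply: eq_Rintegral => y _; rewrite !mxE; ring.
- have tpj j := test_mulr tU (test_smooth (tp j)).
  have Lp j := test_L2 mV (tp j); have Lgp j := test_grad_L2 mV (tp j).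
  have [N N0 gN] : exists2 N, 0 <= N & forall y, edot (grad phi y) (grad phi y) <= N.
    pose b i := projT1 (cid2 (test_bounded (test_partial i tU))).
    have bP i : 0 < b i by exact: (projT2 (cid2 (test_bounded (test_partial i tU)))).1.
    exists (\sum_(i < n) b i ^+ 2); first by apply: sumr_ge0 => i _; exact: sqr_ge0.
    move=> y; apply: ler_sum => i _; rewrite mxE -expr2 -[leLHS]real_normK ?num_real//.
    rewrite ler_pXn2r// ?nnegrE ?(ltW (bP i))//.
    rewrite /b; case: cid2 => /= B B0; exact.
  exists (fun j y => phi y * p j y); split=> //.
  + apply: (@cvg0_squeeze _ _ (fun j =>
        M ^+ 2 * ip V (fun y => p j y - u y) (fun y => p j y - u y) +
        0 * ip V (fun y => p j y - u y) (fun y => p j y - u y))); last first.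
      by apply: cvg0_lin; exact: pu.
    move=> j; apply/andP; split; first by apply: Rintegral_ge0 => y _; exact: sqr_ge0.
    rewrite mul0r addr0 (@Rintegral_restrict _ _ _ V); last first.
      by move=> y /out ->; rewrite !mul0r subrr expr0n.
    have LB := L2B mV (Lp j) Lu; have LpB := Lpu _ LB.
    rewrite /ip -RintegralZl//; last exact: L2_mul.
    apply: le_Rintegral => //.
    * by apply: eq_integrable (L2_mul mV LpB LpB) => // y _ /=; congr EFin; ring.
    * exact: (integrableZl mV (M ^+ 2) (L2_mul mV LB LB)).
    * move=> y _; rewrite -mulrBr exprMn -expr2; apply: ler_wpM2r; first exact: sqr_ge0.
      rewrite -[leLHS]real_normK ?num_real// ler_pXn2r// nnegrE ltW//.
  + apply: (@cvg0_squeeze _ _ (fun j =>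
        2 * M ^+ 2 * vip V (fun y => grad (p j) y - G y) (fun y => grad (p j) y - G y) +
        2 * N * ip V (fun y => p j y - u y) (fun y => p j y - u y))); last first.
      by apply: cvg0_lin; [exact: pG|exact: pu].
    move=> j; apply/andP; split; first by apply: Rintegral_ge0 => y _; exact: edot_ge0.
    pose A y := phi y *: (grad (p j) y - G y).
    pose B y := (p j y - u y) *: grad phi y.
    have LB := L2B mV (Lp j) Lu; have LGB := vL2B mV (Lgp j) LG.
    have LA : vL2 V A by exact: LpG.
    have LBB : vL2 V B by exact: Lug.
    have gE y : grad (fun y => phi y * p j y) y - (phi y *: G y + u y *: grad phi y) =
        1 *: A y + B y.
      apply/rowP => i; rewrite !mxE.
      have -> := congr1 (fun f : Rn -> R => f y) (partialM i sphi (test_smooth (tp j))).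
      ring.
    rewrite (@Rintegral_restrict _ _ _ V); last first.
      by move=> y UV; rewrite gE /A /B (out _ UV) (gout _ UV) scale0r scaler0 scaler0 addr0 edot0l.
    under eq_Rintegral do rewrite gE.
    apply: le_trans (vip_scaleD_le mV 1 LA LBB) _.
    rewrite expr1n mulr1 -(mulrA 2 (M ^+ 2)) -(mulrA 2 N); apply: lerD; apply: ler_wpM2l => //.
    * rewrite /vip -RintegralZl//; last exact: edot_integrable.
      apply: le_Rintegral => //; [exact: edot_integrable| |].
        exact: (integrableZl mV (M ^+ 2) (edot_integrable mV LGB LGB)).
      move=> y _; rewrite /A edotZl edotZr mulrA -expr2; apply: ler_wpM2r; first exact: edot_ge0.
      by rewrite -[leLHS]real_normK ?num_real// ler_pXn2r// nnegrE ltW.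
    * rewrite /ip -RintegralZl//; last exact: L2_mul.
      apply: le_Rintegral => //; [exact: edot_integrable| |].
        exact: (integrableZl mV N (L2_mul mV LB LB)).
      move=> y _; rewrite /B edotZl edotZr mulrA mulrC; apply: ler_wpM2r => //.
      by rewrite -expr2 sqr_ge0.
Qed.

End H10_tools.

Section H10_shift.
Context {R : realType} {n : nat}.
Notation Rn := 'rV[R]_n.
Notation mu := (lebesgue_rV R n).
Implicit Types (U V : set Rn) (f g h u v w phi psi : Rn -> R) (F G H : Rn -> Rn).

Lemma measurable_fun_shift U f (a : Rn) : measurable U -> measurable_fun U f ->
  measurable_fun ((fun y : Rn => y + a) @^-1` U) (fun y => f (y + a)).
Proof.
move=> mU mf; apply: (measurable_comp mU _ mf); last first.
  exact: measurable_funS (measurable_shift a).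
by move=> _ [y Uy <-].
Qed.

Lemma L2_shift U f (a : Rn) : measurable U -> L2 U f ->
  L2 ((fun y : Rn => y + a) @^-1` U) (fun y => f (y + a)).
Proof.
move=> mU [mf fi]; split; first exact: measurable_fun_shift.
rewrite (ge0_integral_shift a (f := fun y => (f y ^+ 2)%:E))//.
- by apply/measurable_EFinP; exact: measurable_funX.
- by move=> y; rewrite lee_fin sqr_ge0.
Qed.

Lemma grad_shift phi (a : Rn) y : grad (fun y => phi (y + a)) y = grad phi (y + a).
Proof. by apply/rowP => i; rewrite !mxE partial_shift. Qed.

(** The translates of the approximating test functions approximate the
    translate. *)
Lemma H10_shift U u G (a : Rn) : measurable U -> H10_gradient U u G ->
  H10_gradient ((fun y : Rn => y + a) @^-1` U) (fun y => u (y + a)) (fun y => G (y + a)).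
Proof.
move=> mU [Lu LG wG [p [tp pu pG]]].
have mp j D : measurable_fun D (p j).
  by apply: continuous_measurable_rV; apply: smooth_continuous; exact: test_smooth (tp j).
split.
- exact: L2_shift.
- by move=> i; exact: (L2_shift a mU (LG i)).
- move=> psi tpsi i.
  have tpsi' : test_function U (fun y => psi (y - a)).
    have := test_shift (- a) tpsi; congr test_function.
    by apply/seteqP; split => y /=; rewrite subrK.
  have mpsi i' D : measurable_fun D (partial i' (fun y : Rn => psi (y - a))).
    apply: continuous_measurable_rV; apply: smooth_continuous; apply: smooth_partial.
    exact: test_smooth tpsi'.
  have mpsi' D : measurable_fun D (fun y : Rn => psi (y - a)).
    by apply: continuous_measurable_rV; apply: smooth_continuous; exact: test_smooth tpsi'.
  have h := wG _ tpsi' i.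
  transitivity (\int[mu]_(y in U) (u y * partial i (fun y => psi (y - a)) y)).
    rewrite -(Rintegral_shift a mU); last first.
      by apply: measurable_funM => //; case: Lu.
    by apply: eq_Rintegral => y _; rewrite partial_shift addrK.
  rewrite h -(Rintegral_shift a mU); last first.
    by apply: measurable_funM => //; case: (LG i).
  by congr (- _); apply: eq_Rintegral => y _; rewrite addrK.
- exists (fun j y => p j (y + a)); split.
  + by move=> j; exact: test_shift.
  + rewrite (_ : (fun j => _) = fun j => \int[mu]_(y in U) ((p j y - u y) ^+ 2)); first exact: pu.
    apply/funext => j.
    rewrite -(Rintegral_shift a (f := fun y => (p j y - u y) ^+ 2))//.
    by apply: measurable_funX; apply: measurable_funB => //; case: Lu.
  + rewrite (_ : (fun j => _) = fun j => \int[mu]_(y in U)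
        edot (grad (p j) y - G y) (grad (p j) y - G y)); first exact: pG.
    apply/funext => j.
    have LB := vL2B mU (test_grad_L2 mU (tp j)) LG.
    have /integrableP[/measurable_EFinP mB _] := edot_integrable mU LB LB.
    rewrite -(Rintegral_shift a mU mB).
    by apply: eq_Rintegral => y _; rewrite grad_shift.
Qed.

End H10_shift.

(** * The Dirichlet form and weak convergence *)

Section bessel.
Context {R : realType} {n : nat}.
Notation Rn := 'rV[R]_n.
Variable U : set Rn.
Hypothesis mU : measurable U.
Implicit Types (v w z : Rn -> R).

Lemma H10_lin (a : R) v w : H10 U v -> H10 U w -> H10 U (fun y => a * v y + w y).
Proof. by move=> [G vG] [H wH]; exists (fun y => a *: G y + H y); exact: H10_gradient_lin. Qed.

Lemma H10_0 : H10 U (fun=> 0).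
Proof. by exists (fun=> 0); exact: H10_gradient0. Qed.

Lemma H10Z (a : R) v : H10 U v -> H10 U (fun y => a * v y).
Proof. by move=> vU; have := H10_lin a vU H10_0; under eq_fun do rewrite addr0. Qed.

Lemma dirichletC v w : dirichlet U v w = dirichlet U w v.
Proof. exact: vipC. Qed.

Lemma dirichlet_ge0 v : 0 <= dirichlet U v v.
Proof. exact: vip_ge0. Qed.

Lemma dirichlet_lin (a : R) v w z : H10 U v -> H10 U w -> H10 U z ->
  dirichlet U (fun y => a * v y + w y) z = a * dirichlet U v z + dirichlet U w z.
Proof.
move=> vU wU zU; have vW := wgradP vU; have wW := wgradP wU; have zW := wgradP zU.
rewrite (dirichletE mU (H10_gradient_lin a mU vW wW) zW).
have [_ Lv _ _] := vW; have [_ Lw _ _] := wW; have [_ Lz _ _] := zW.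
rewrite /dirichlet; exact: (vip_scaleDl mU a Lv Lw Lz).
Qed.

Lemma dirichlet0l z : H10 U z -> dirichlet U (fun=> 0) z = 0.
Proof.
move=> zU; have := dirichlet_lin 1 H10_0 H10_0 zU.
rewrite (_ : (fun _ => _) = fun=> 0); last by apply/funext => y; rewrite mulr0 addr0.
by rewrite mul1r => /eqP; rewrite -subr_eq0 opprD addrA subrr sub0r oppr_eq0 => /eqP.
Qed.

Lemma dirichletZ (a : R) v z : H10 U v -> H10 U z ->
  dirichlet U (fun y => a * v y) z = a * dirichlet U v z.
Proof.
move=> vU zU; have := dirichlet_lin a vU H10_0 zU.
by under [X in dirichlet U X]eq_fun do rewrite addr0; rewrite dirichlet0l// addr0.
Qed.

Lemma dirichlet_CS v w : H10 U v -> H10 U w ->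
  dirichlet U v w ^+ 2 <= dirichlet U v v * dirichlet U w w.
Proof.
move=> vU wU; have [_ Lv _ _] := wgradP vU; have [_ Lw _ _] := wgradP wU.
exact: (vip_CS mU Lv Lw).
Qed.

Lemma H10_normE v : H10_norm U v = Num.sqrt (dirichlet U v v).
Proof. by []. Qed.

Lemma Hm1_0 l : Hm1 U l -> l (fun=> 0) = 0.
Proof.
move=> [ll _]; have := ll 1 _ _ H10_0 H10_0.
rewrite (_ : (fun _ => _) = fun=> 0); last by apply/funext => y; rewrite mulr0 addr0.
by rewrite mul1r => /eqP; rewrite -subr_eq0 opprD addrA subrr sub0r oppr_eq0 => /eqP.
Qed.

(** Bessel inequality. For w the sum of the l(v_k) v_k with k < m, the bound on
    l and the orthogonality give (sum of l(v_k)^2)^2 = l(w)^2 <= C^2 M (sum of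
    l(v_k)^2). Hence the series of l(v_k)^2 converges, and l(v_k) tends to 0. *)
Lemma orthogonal_weakly_null (v_ : nat -> Rn -> R) (M : R) :
  (forall k, H10 U (v_ k)) -> (forall i j, i != j -> dirichlet U (v_ i) (v_ j) = 0) ->
  (forall k, dirichlet U (v_ k) (v_ k) <= M) -> weakly_null U v_.
Proof.
move=> vU orth bnd; split=> // l lH; rewrite (Hm1_0 lH).
have [ll [C lC]] := lH.
pose c k := l (v_ k).
pose w := fix w (m : nat) : Rn -> R :=
  if m is m'.+1 then fun y => c m' * v_ m' y + w m' y else fun=> 0.
pose S (m : nat) := \sum_(0 <= k < m) c k ^+ 2.
have S0 m : 0 <= S m by apply: sumr_ge0 => k _; exact: sqr_ge0.
have M0 : 0 <= M by apply: le_trans (bnd 0%N); exact: dirichlet_ge0.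
have P m : [/\ H10 U (w m), l (w m) = S m,
    forall k, (m <= k)%N -> dirichlet U (w m) (v_ k) = 0 & dirichlet U (w m) (w m) <= M * S m].
  elim: m => [|m [wU lw wv ww]].
    split=> /=; [exact: H10_0|by rewrite (Hm1_0 lH) /S big_nil| |].
      by move=> k _; exact: dirichlet0l.
    by rewrite dirichlet0l ?mulr_ge0//; exact: H10_0.
  have wU' : H10 U (w m.+1) by apply: H10_lin.
  split=> //=.
  - by rewrite ll// lw /S big_nat_recr//= addrC -expr2.
  - by move=> k mk; rewrite dirichlet_lin// orth ?(ltn_eqF mk)// mulr0 add0r wv// ltnW.
  - rewrite dirichlet_lin// [dirichlet U (v_ m) _]dirichletC [dirichlet U (w m) _]dirichletC.
    rewrite !dirichlet_lin// [dirichlet U (v_ m) (w m)]dirichletC (wv m (leqnn m)).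
    rewrite mulr0 add0r addr0 mulrA -expr2 /S big_nat_recr//= -/(S m) mulrDr addrC.
    by apply: lerD => //; rewrite mulrC ler_wpM2r ?sqr_ge0.
have Sbnd m : S m <= C ^+ 2 * M.
  have [wU lw _ ww] := P m.
  have [->|Sm0] := eqVneq (S m) 0; first by rewrite mulr_ge0 ?sqr_ge0.
  have Sp : 0 < S m by rewrite lt_neqAle eq_sym Sm0 S0.
  rewrite -(ler_pM2r Sp) -expr2 -mulrA.
  have h := lC _ wU; rewrite lw (ger0_norm (S0 m)) in h.
  apply: (@le_trans _ _ ((C * H10_norm U (w m)) ^+ 2)).
    by rewrite ler_pXn2r// ?nnegrE ?S0// (le_trans (S0 m)).
  rewrite exprMn; apply: ler_wpM2l; first exact: sqr_ge0.
  by rewrite H10_normE sqr_sqrtr ?dirichlet_ge0.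
have cv : cvgn (series (fun k => c k ^+ 2)).
  apply: nondecreasing_is_cvgn.
    apply/nondecreasing_seqP => m; rewrite /series/= big_nat_recr//= lerDl.
    exact: sqr_ge0.
  by exists (C ^+ 2 * M) => _ [m _ <-]; exact: Sbnd.
apply: (@cvg_of_sqr_le _ _ (fun k => c k ^+ 2) 0 1); last exact: cvg_series_cvg_0.
by move=> k; rewrite subr0 mulr1.
Qed.

End bessel.

(** * The dual norm of the characteristic function of a ball *)

Section dual_norm_of_ball.
Context {R : realType} {n : nat}.
Notation Rn := 'rV[R]_n.
Notation mu := (lebesgue_rV R n).
Variables (s r : R).
Hypotheses (n_gt0 : (0 < n)%N) (r_gt0 : 0 < r) (r_lt_s : r < s).
Notation B := (eball (0 : Rn) s).
Notation chi := (\1_(eball (0 : Rn) r) : Rn -> R).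

Let mB : measurable B. Proof. by apply: open_measurable_rV; exact: eball_open. Qed.

Let mb (x : Rn) t : measurable (eball x t).
Proof. by apply: open_measurable_rV; exact: eball_open. Qed.

Lemma eball_finite (a : Rn) (t : R) : 0 <= t -> (mu (eball a t) < +oo)%E.
Proof.
move=> t0; apply: le_lt_trans (box_finite a t0).
apply: le_measure; last exact: eball_sub_box.
  by rewrite inE; exact: mb.
by rewrite inE; exact: measurable_box.
Qed.

Lemma L2_chi : L2 B chi.
Proof. by apply: L2_indic => //; apply: eball_finite; exact: ltW. Qed.

Lemma box_sub_eball (a : Rn) : box a (r / n.+1%:R) `<=` eball a r.
Proof.
move=> y ya; rewrite /eball/= enorm_lt ?(ltW r_gt0)//.
have n1 : (0 : R) < n.+1%:R by rewrite ltr0n.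
apply: (@le_lt_trans _ _ (\sum_(i < n) (r / n.+1%:R) ^+ 2)).
  apply: ler_sum => i _; rewrite -expr2 -[leLHS]real_normK ?num_real//.
  rewrite ler_pXn2r// ?nnegrE ?normr_ge0 ?divr_ge0 ?ltW//.
  by have := ya i; rewrite !mxE.
rewrite sumr_const card_ord -[ltLHS]mulr_natr.
rewrite [ltLHS](_ : _ = r ^+ 2 * (n%:R / n.+1%:R ^+ 2)); last first.
  by rewrite expr_div_n; move: (r ^+ 2) => x; rewrite -mulrA [_^-1 * _]mulrC.
rewrite gtr_pMr ?exprn_gt0// ltr_pdivrMr ?exprn_gt0// mul1r expr2 -natrM ltr_nat.
by rewrite mulSn ltn_addr.
Qed.

Lemma ip_chi_gt0 : 0 < ip B chi chi.
Proof.
have n1 : (0 : R) < n.+1%:R by rewrite ltr0n.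
have e0 : 0 < r / n.+1%:R by rewrite divr_gt0.
pose b := box (0 : Rn) (r / n.+1%:R).
have bb := @box_sub_eball 0.
have bB : b `<=` B.
  by move=> y /bb; rewrite /eball/= => /lt_trans; exact.
apply: (@lt_le_trans _ _ (ip B (\1_b) (\1_b))); last first.
  apply: (le_ip mB) L2_chi _ => [|y _]; first by apply: measurable_indic; exact: measurable_box.
  rewrite !indicE; case: (boolP (y \in b)) => [/[!inE] /bb yb|_]; first by rewrite mem_set.
  by rewrite /= expr0n /= sqr_ge0.
rewrite /ip; under eq_Rintegral.
  move=> y _; rewrite (_ : \1_b y * \1_b y = \1_b y); last first.
    by rewrite indicE; case: (_ \in _); rewrite ?mulr1 ?mulr0.
  over.
rewrite /Rintegral integral_indic//; last exact: measurable_box.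
rewrite (setIidl bB) -[X in fine X]/(mu b) lebesgue_rV_box ?(ltW e0)//=.
by apply: exprn_gt0; exact: mulr_gt0.
Qed.

Notation l := (functional_of B chi).
Notation N := (Hm1_norm B l).

(** Cauchy-Schwarz and Poincare inequalities. Boundedness matters for the
    normalization of the construction: the supremum that defines the dual norm
    would otherwise be 0 by convention. *)
Lemma functional_bounded : exists2 K : R, 0 <= K & forall v, H10 B v -> `|l v| <= K * H10_norm B v.
Proof.
pose K := Num.sqrt (ip B chi chi * (4 * s ^+ 2)).
exists K => [|v vB]; first exact: sqrtr_ge0.
have vG := wgradP vB; have [Lv LG _ _] := vG.
have i : 'I_n by exact: Ordinal n_gt0.
have h1 := ip_CS mB L2_chi Lv.
have h2 : ip B v v <= 4 * s ^+ 2 * dirichlet B v v.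
  apply: le_trans (poincare (i := i) (a := s) mB _ vG) _.
    move=> y; rewrite /eball/= subr0 => ys.
    by apply: ltW; apply: le_lt_trans ys; exact: coord_le_enorm.
  apply: ler_wpM2l; first by apply: mulr_ge0 => //; exact: sqr_ge0.
  exact: ip_le_vip.
have chi0 := ip_chi_gt0.
rewrite /K H10_normE -sqrtrM; last first.
  by apply: mulr_ge0; [exact: ltW|apply: mulr_ge0 => //; exact: sqr_ge0].
rewrite -sqrtr_sqr ler_wsqrtr//.
apply: le_trans h1 _; rewrite -mulrA; apply: ler_wpM2l => //; exact: ltW.
Qed.

Let S := [set `|l v| | v in [set v | H10 B v /\ H10_norm B v <= 1]].

Let S_ub : has_ubound S.
Proof.
have [K K0 lK] := functional_bounded; exists K => _ [v [vB v1] <-].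
by apply: le_trans (lK v vB) _; rewrite -[leRHS]mulr1 ler_wpM2l.
Qed.

Let S0 : S !=set0.
Proof.
exists `|l (fun=> 0)|; exists (fun=> 0) => //; split; first exact: H10_0.
by rewrite H10_normE dirichlet0l ?sqrtr0//; exact: H10_0.
Qed.

Lemma le_Hm1_norm v : H10 B v -> H10_norm B v <= 1 -> `|l v| <= N.
Proof. by move=> vB v1; apply: (ub_le_sup S_ub); exists v. Qed.

Lemma functionalZ (a : R) v : H10 B v -> l (fun y => a * v y) = a * l v.
Proof.
move=> /wgradP[Lv _ _ _]; rewrite /functional_of -RintegralZl//; last exact: (L2_mul mB L2_chi Lv).
by apply: eq_Rintegral => y _; rewrite mulrCA.
Qed.

Lemma H10_normZ (a : R) v : H10 B v -> H10_norm B (fun y => a * v y) = `|a| * H10_norm B v.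
Proof.
move=> vB; have vaB := H10Z mB a vB; rewrite !H10_normE.
rewrite dirichletZ// dirichletC dirichletZ// mulrA -expr2 sqrtrM ?sqr_ge0//.
by rewrite sqrtr_sqr.
Qed.

Lemma functional_le v : H10 B v -> `|l v| <= N * H10_norm B v.
Proof.
move=> vB; have [K K0 lK] := functional_bounded.
have n0 : 0 <= H10_norm B v by exact: sqrtr_ge0.
have [v0|v0] := eqVneq (H10_norm B v) 0.
  by have := lK v vB; rewrite v0 !mulr0.
have vp : 0 < H10_norm B v by rewrite lt_neqAle eq_sym v0.
have := @le_Hm1_norm (fun y => (H10_norm B v)^-1 * v y) (H10Z mB _ vB).
rewrite H10_normZ// functionalZ// gtr0_norm ?invr_gt0// mulVf// lexx => /(_ isT).
by rewrite normrM gtr0_norm ?invr_gt0// mulrC ler_pdivrMr.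
Qed.

(** The functional does not vanish on a cutoff function equal to 1 on the ball
    of radius r. *)
Lemma Hm1_norm_gt0 : 0 < N.
Proof.
have h1 := r_lt_s; have h2 := r_gt0.
have rs : r < (r + s) / 2 by lra.
have rs2 : (r + s) / 2 < s by lra.
have rs0 : 0 <= (r + s) / 2 by lra.
have [phi [sphi phis phi01 phi1 _]] := cutoff_exists (0 : Rn) r_gt0 rs.
have tphi : test_function B phi.
  apply: (@test_functionW _ _ _ [set y | enorm (y - 0) <= (r + s) / 2]) => //.
    exact: cball_compact.
  by move=> y /= ys; rewrite /eball/=; exact: le_lt_trans rs2.
have pB : H10 B phi by exists (grad phi); exact: test_H10.
have lphi : l phi = ip B chi chi.
  apply: eq_Rintegral => y _; rewrite indicE; case: (boolP (y \in _)) => [/[!inE] yr|_].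
    by rewrite phi1// ltW.
  by rewrite !mul0r.
have := functional_le pB; rewrite lphi gtr0_norm ?ip_chi_gt0// => h.
have := lt_le_trans ip_chi_gt0 h.
have n0 : 0 <= H10_norm B phi by exact: sqrtr_ge0.
have [->|N0] := eqVneq (H10_norm B phi) 0; first by rewrite mulr0 ltxx.
by rewrite pmulr_lgt0// lt_neqAle eq_sym N0.
Qed.

(** Write D for the energy of u and N for the dual norm. Testing the equation
    with u gives D = c l(u) <= c N sqrt D; testing it with an arbitrary v of
    norm at most 1 gives c |l(v)| <= sqrt D, hence c N <= sqrt D. Now c N = sqrt
    2. *)
Lemma poisson_energy (c : R) u : c = Num.sqrt 2 / N ->
  poisson_solution B (fun y => c * chi y) u ->
  dirichlet B u u = 2 /\ forall v, H10 B v -> dirichlet B u v = c * l v.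
Proof.
move=> cE [uB up].
have N0 := Hm1_norm_gt0.
have s2 : 0 < Num.sqrt (2 : R) by rewrite sqrtr_gt0.
have c0 : 0 < c by rewrite cE divr_gt0.
have cN : c * N = Num.sqrt 2 by rewrite cE divfK// gt_eqF.
have E v : H10 B v -> dirichlet B u v = c * l v.
  move=> vB; have [Lv _ _ _] := wgradP vB.
  rewrite /dirichlet /vip up// /functional_of -RintegralZl//; last exact: (L2_mul mB L2_chi Lv).
  by apply: eq_Rintegral => y _; rewrite mulrA.
split=> //.
set D := dirichlet B u u.
have D0 : 0 <= D by exact: dirichlet_ge0.
have nu : H10_norm B u = Num.sqrt D by [].
apply/eqP; rewrite eq_le; apply/andP; split.
  have h : D <= Num.sqrt 2 * Num.sqrt D.
    rewrite {1}/D E// -cN -mulrA ler_pM2l// -nu.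
    exact: le_trans (ler_norm _) (functional_le uB).
  have [->//|Dn0] := eqVneq D 0.
  have Dp : 0 < D by rewrite lt_neqAle eq_sym Dn0.
  rewrite -(ler_pM2r Dp) -[2 in leRHS](sqr_sqrtr (_ : 0 <= 2))//.
  rewrite -[X in _ <= _ * X](sqr_sqrtr D0) -exprMn -expr2.
  by rewrite ler_pXn2r// nnegrE// mulr_ge0 ?sqrtr_ge0.
have : N <= Num.sqrt D / c.
  apply: ge_sup => // _ [v [vB v1] <-].
  rewrite ler_pdivlMr// mulrC -{1}(gtr0_norm c0) -normrM -E//.
  rewrite -(@ler_pXn2r _ 2)// ?nnegrE ?sqrtr_ge0 ?normr_ge0//.
  rewrite real_normK ?num_real// sqr_sqrtr//.
  apply: le_trans (dirichlet_CS mB uB vB) _.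
  rewrite -[leRHS]mulr1 ler_wpM2l//.
  by rewrite H10_normE -sqrtr1 ler_sqrt// in v1.
by rewrite ler_pdivlMr// mulrC cN ler_sqrt.
Qed.

End dual_norm_of_ball.

(** * A competitor of negative energy *)

Section competitor.
Context {R : realType} {n : nat}.
Notation Rn := 'rV[R]_n.
Notation mu := (lebesgue_rV R n).

(** Young inequality. The constant in front of the first term has to be less
    than 2 for the energy of the competitor below to be negative. *)
Lemma vip_sumsq_le (U : set Rn) (F G : Rn -> Rn) : measurable U -> vL2 U F -> vL2 U G ->
  vip U (fun y => F y + G y) (fun y => F y + G y) <= 3 / 2 * vip U F F + 3 * vip U G G.
Proof.
move=> mU LF LG.
have := vip_ge0 U (fun y => - 2^-1 *: F y + G y).
rewrite vip_sqr// => h.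
have := vip_sqr mU 1 LF LG.
rewrite (_ : (fun y => 1 *: F y + G y) = (fun y => F y + G y)); last first.
  by apply/funext => y; rewrite scale1r.
move=> ->.
lra.
Qed.

Lemma eball_shift (x : Rn) (s : R) : (fun y : Rn => y - x) @^-1` eball 0 s = eball x s.
Proof. by apply/seteqP; split => y /=; rewrite /eball/= subr0. Qed.

(** The competitor is the translate of u multiplied by a cutoff phi. Since phi =
    1 where the force c chi lives, the work of the force is not changed by phi
    and equals the Dirichlet energy of u, that is 2. In the gradient phi grad u
    + u grad phi the first term has energy at most 2, and the second one is
    bounded by means of the L^2 norm of u and of the gap rho - r. *)
Lemma competitor (s r rho c : R) (U : set Rn) (x : Rn) (u : Rn -> R) :
  (0 < n)%N -> 0 < r -> r < rho -> rho < s -> open U ->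
  [set y | enorm (y - x) <= rho] `<=` U ->
  let chi : Rn -> R := \1_(eball (0 : Rn) r) in
  c = Num.sqrt 2 / Hm1_norm (eball 0 s) (functional_of (eball 0 s) chi) ->
  poisson_solution (eball 0 s) (fun y => c * chi y) u ->
  exists v G,
  [/\ H10_gradient U v G, forall y, rho < enorm (y - x) -> G y = 0,
      vip U G G <= 3 + 3 * ((cutoff_cst / (rho - r)) ^+ 2 * ip (eball 0 s) u u) &
      \int[mu]_(y in U) (c * chi (y - x) * v y) = 2].
Proof.
move=> n0 r0 rrho rhos oU KU chi cE up.
pose B := eball (0 : Rn) s; pose V := eball x s.
pose K := [set y | enorm (y - x) <= rho].
have rs : r < s := lt_trans rrho rhos.
have rho0 : 0 < rho := lt_trans r0 rrho.
have mU : measurable U := open_measurable_rV oU.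
have mB : measurable B by apply: open_measurable_rV; exact: eball_open.
have mV : measurable V by apply: open_measurable_rV; exact: eball_open.
have KV : K `<=` V by move=> y /le_lt_trans; apply.
have [D2 Dl] := poisson_energy n0 r0 rs cE up.
have [uB _] := up.
have uG := wgradP uB; have [Lu LG _ _] := uG.
have := H10_shift (- x) mB uG; rewrite eball_shift -/V => uG'.
set u' := (fun y => u (y - x)) in uG'; set G' := (fun y => wgrad B u (y - x)) in uG'.
have [Lu' LG' _ _] := uG'.
have [phi [sphi phiK phi01 phi1 gphi]] := cutoff_exists x r0 rrho.
have cK : compact K by exact/cball_compact/ltW.
have tK : test_function K phi by exact: (@test_functionW _ _ _ K).
have sK : support phi `<=` K by have [] := tK.
have tU : test_function U phi by apply: (test_sub tK); exact: subset_trans KU.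
have tV : test_function V phi by apply: (test_sub tK); exact: subset_trans KV.
have vG := H10_cutoff mU mV tU tV uG'.
have outK y : ~ K y -> phi y = 0 by exact: test_out.
have goutK y : ~ K y -> grad phi y = 0.
  by move=> Ky; apply/rowP => i; rewrite !mxE; exact: (test_out (test_partial i tK)).
exists (fun y => phi y * u' y), (fun y => phi y *: G' y + u' y *: grad phi y).
split=> //.
- move=> y yrho; have Ky : ~ K y by rewrite /K/= leNgt yrho.
  by rewrite outK// goutK// scale0r scaler0 addr0.
- rewrite /vip (@Rintegral_restrict _ _ _ V); last first.
    move=> y UV; have Ky : ~ K y by move=> Ky; apply: UV; split; [exact: KU|exact: KV].
    by rewrite outK// goutK// scale0r scaler0 addr0 edot0l.
  have mphi : measurable_fun V phi by apply: continuous_measurable_rV; exact: smooth_continuous.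
  have phib y : V y -> `|phi y| <= 1.
    by move=> _; have /andP[p0 p1] := phi01 y; rewrite ger0_norm.
  have LA : vL2 V (fun y => phi y *: G' y).
    by move=> i; have := L2_mulb mV mphi phib (LG' i); congr L2; apply/funext => y; rewrite mxE.
  have LB : vL2 V (fun y => u' y *: grad phi y).
    move=> i; have [M _ phiM] := test_bounded (test_partial i tK).
    have md : measurable_fun V (partial i phi).
      by apply: continuous_measurable_rV; apply: smooth_continuous; exact: smooth_partial.
    have := L2_mulb mV md (fun y _ => phiM y) Lu'.
    by congr L2; apply/funext => y; rewrite !mxE mulrC.
  apply: le_trans (vip_sumsq_le mV LA LB) _; apply: lerD.
    rewrite [leRHS](_ : 3 = 3 / 2 * 2 :> R); last by field.
    apply: ler_wpM2l; first by rewrite divr_ge0.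
    rewrite -D2 /dirichlet /vip.
    have /integrableP[/measurable_EFinP mG _] := edot_integrable mB LG LG.
    rewrite -(Rintegral_shift (- x) mB mG) eball_shift -/V.
    apply: le_Rintegral => //; [exact: edot_integrable|exact: (edot_integrable mV LG' LG')|].
    move=> y _; rewrite edotZl edotZr mulrA -[leRHS]mul1r; apply: ler_wpM2r; first exact: edot_ge0.
    by have /andP[p0 p1] := phi01 y; rewrite mulr_ile1.
  apply: ler_wpM2l => //.
  have mu2 : measurable_fun B (fun y => u y * u y) by apply: measurable_funM; case: Lu.
  have iu' := L2_mul mV Lu' Lu'.
  rewrite /ip -(Rintegral_shift (- x) mB mu2) eball_shift -/V -RintegralZl//.
  apply: le_Rintegral => //; [exact: edot_integrable|exact: (integrableZl mV _ iu')|].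
  move=> y _; rewrite edotZl edotZr mulrA mulrC -/(u' y); apply: ler_wpM2r => //.
  by rewrite -expr2 sqr_ge0.
- rewrite (@Rintegral_restrict _ _ _ V); last first.
    move=> y UV; have Ky : ~ K y by move=> Ky; apply: UV; split; [exact: KU|exact: KV].
    by rewrite outK// mul0r mulr0.
  rewrite -[RHS]D2 Dl// /functional_of -RintegralZl//; last first.
    exact: (L2_mul mB (L2_chi s r0) Lu).
  have mcu : measurable_fun B (fun y => c * (chi y * u y)).
    apply: measurable_funM => //; apply: measurable_funM; last by case: Lu.
    by have [] := L2_chi (n := n) s r0.
  rewrite -(Rintegral_shift (- x) mB mcu) eball_shift -/V.
  apply: eq_Rintegral => y _; rewrite -mulrA; congr (_ * _).
  rewrite /chi indicE; case: (boolP (_ \in _)) => [/[!inE] yr|_]; last by rewrite !mul0r.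
  by rewrite phi1 ?mul1r// ltW//; move: yr; rewrite /eball/= subr0.
Qed.

End competitor.

(** * A subsequence of disjoint balls *)

Section separation.
Context {R : realType} {n : nat}.
Notation Rn := 'rV[R]_n.
(** Choose m (j+1) such that twice the distance from the new centre to x0 is
    less than the distance from x0 to the ball of index m j. All later balls
    then lie in a ball around x0 that misses the earlier ones. *)
Lemma disjoint_subsequence (x : nat -> Rn) (x0 : Rn) (rho : nat -> R) (N : nat) :
  enorm (x k - x0) @[k --> \oo] --> 0 -> (forall k, (N <= k)%N -> 0 <= rho k) ->
  (forall k, (N <= k)%N -> rho k < enorm (x k - x0)) ->
  exists m : nat -> nat,
  [/\ forall j, (N <= m j)%N, forall i j, (i < j)%N -> (m i < m j)%N &
      forall i j y, (i < j)%N -> enorm (y - x (m i)) < rho (m i) ->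
        enorm (y - x (m j)) < rho (m j) -> False].
Proof.
move=> d0 rho0 rhod; pose d k := enorm (x k - x0).
pose rel a b := (a < b)%N /\ ((N <= a)%N -> 2 * d b < d a - rho a).
have step_ a : {b | rel a b}.
  apply/cid; have [Na|aN] := leqP N a; last first.
    by exists a.+1; split=> // /(leq_trans aN); rewrite ltnn.
  have h : 0 < (d a - rho a) / 2 by rewrite divr_gt0// subr_gt0 rhod.
  have /cvgr0_norm_lt/(_ _ h)[M _ HM] := d0.
  exists (maxn M a.+1); split; first by rewrite leq_maxr.
  move=> _; have := HM (maxn M a.+1) (leq_maxl _ _); rewrite /= ger0_norm ?enorm_ge0//.
  by rewrite ltr_pdivlMr// mulrC.
have [m [m0 mS]] := dependent_choice step_ N.
have minc i j : (i < j)%N -> (m i < m j)%N.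
  elim: j => // j IH; rewrite ltnS leq_eqVlt => /predU1P[->|/IH ij]; first exact: (mS j).1.
  exact: ltn_trans ij (mS j).1.
have mN j : (N <= m j)%N.
  by elim: j => [|j IH]; [rewrite m0|exact: leq_trans IH (ltnW (mS j).1)].
exists m; split=> // i j y ij yi yj.
have dd : 2 * d (m j) < d (m i) - rho (m i).
  elim: j ij {yj} => // j IH; rewrite ltnS leq_eqVlt => /predU1P[->|/IH {}IH].
    exact: (mS j).2.
  have h1 := (mS j).2 (mN j); have h2 := rho0 _ (mN j).
  have h3 : 0 <= d (m j) by exact: enorm_ge0.
  lra.
have h1 := enormD (y - x (m j)) (x (m j) - x0); rewrite addrA subrK in h1.
have h2 := enormD (x (m i) - y) (y - x0); rewrite addrA subrK enormB in h2.
have h3 := rhod _ (mN j).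
rewrite -/(d _) in h1 h3; rewrite -/(d _) in h2.
by move: yi yj dd h1 h2 h3 {ij}; clear; lra.
Qed.

End separation.

(** * From oscillating energies to the failure of convergence *)

Section limits.
Context {R : realType}.
Implicit Types (u : nat -> \bar R) (l : \bar R).

Lemma limn_esup_ge u l : (forall N, exists2 k, (N <= k)%N & (l <= u k)%E) -> (l <= limn_esup u)%E.
Proof.
move=> ul; rewrite limn_esup_lim; apply: lime_ge; first exact: is_cvg_esups.
apply: nearW => N; have [k Nk lk] := ul N.
by apply: le_trans lk _; apply: ereal_sup_ubound; exists k.
Qed.

Lemma limn_einf_le u l : (forall N, exists2 k, (N <= k)%N & (u k <= l)%E) -> (limn_einf u <= l)%E.
Proof.
move=> ul; rewrite limn_einf_lim; apply: lime_le; first exact: is_cvg_einfs.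
apply: nearW => N; have [k Nk lk] := ul N.
by apply: le_trans _ lk; apply: ereal_inf_lbound; exists k.
Qed.

End limits.

Section nonconvergence.
Context {R : realType} {n : nat}.
Notation Rn := 'rV[R]_n.

(** The sequence v_ shows that - nu' is at most - c; as it eventually enters
    every weak neighbourhood of 0, the Gamma-liminf at 0 is at most - c as well.
    Infinitely many of the functionals are nonnegative, which bounds - nu'' and
    the Gamma-limsup at 0 from below by 0. *)
Lemma nonconvergence (U : set Rn) (f_ : nat -> Rn -> R) (sigma : nat -> nat)
    (v_ : nat -> Rn -> R) (c : R) : measurable U -> 0 < c -> weakly_null U v_ ->
  (forall N, exists2 k, (N <= k)%N & energy (f_ (sigma k)) (v_ k) U <= - c) ->
  (forall N, exists2 k, (N <= k)%N & forall w, H10 U w -> 0 <= energy (f_ (sigma k)) w U) ->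
  nu' f_ sigma U <> nu'' f_ sigma U /\
  ~ Gamma_converges U (fun k v => energy (f_ (sigma k)) v U).
Proof.
move=> mU c0 vnull low high; have [vU vcvg] := vnull.
have cneg : ((- c)%:E < 0 :> \bar R)%E by rewrite lte_fin oppr_lt0.
split.
- rewrite /nu' /nu'' => /oppe_inj e.
  have h1 : (ereal_inf [set limn_einf (fun k => (energy (f_ (sigma k)) (v_ k) U)%:E)
               | v_ in weakly_null U] <= (- c)%:E)%E.
    apply: (@le_trans _ _ (limn_einf (fun k => (energy (f_ (sigma k)) (v_ k) U)%:E))).
      by apply: ereal_inf_lbound; exists v_.
    by apply: limn_einf_le => N; have [k Nk h] := low N; exists k.
  have h2 : (0 <= ereal_inf [set limn_esup (fun k => (energy (f_ (sigma k)) (v_ k) U)%:E)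
               | v_ in weakly_null U])%E.
    apply: le_ereal_inf_tmp => _ [w [wU _] <-].
    by apply: limn_esup_ge => N; have [k Nk h] := high N; exists k => //; rewrite lee_fin h.
  by rewrite -e in h2; have := le_lt_trans (le_trans h2 h1) cneg; rewrite ltxx.
- move=> /(_ _ (H10_0 mU)) e.
  pose G k v := energy (f_ (sigma k)) v U.
  have h1 : (Gamma_liminf U G (fun=> 0%R) <= (- c)%:E)%E.
    apply: ge_ereal_sup => _ [Nb [_ [m [l [eps [lH eps0 sub]]]]] <-].
    have : \forall k \near \oo, Nb (v_ k).
      have : \forall k \near \oo, forall i, `|l i (v_ k) - l i (fun=> 0)| < eps.
        apply: filter_forall => i.
        have /cvgrPdist_lt/(_ _ eps0) := vcvg _ (lH i).
        by apply: filterS => k; rewrite distrC.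
      by apply: filterS => k hk; apply: sub.
    move=> [K _ HK]; apply: limn_einf_le => N; have [k] := low (maxn K N).
    rewrite geq_max => /andP[Kk Nk] h; exists k => //.
    apply: (@le_trans _ _ (G k (v_ k))%:E) => //; apply: ereal_inf_lbound.
    by exists (v_ k) => //; exact: HK.
  have h2 : (0 <= Gamma_limsup U G (fun=> 0%R))%E.
    apply: le_trans (ereal_sup_ubound _); last first.
      (* the whole space, a weak neighbourhood defined by no functional *)
      exists (H10 U) => //; split=> //; exists 0%N, (fun _ _ => 0), 1; split=> //; first by case.
      by move=> w [].
    apply: limn_esup_ge => N; have [k Nk h] := high N; exists k => //.
    by apply: le_ereal_inf_tmp => _ [w wU <-]; rewrite lee_fin h.
  rewrite -/G in e; rewrite -e in h2.
  by have := le_lt_trans (le_trans h2 h1) cneg; rewrite ltxx.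
Qed.

End nonconvergence.

(** * The radii of the construction *)

Lemma increasing_ge (sigma : nat -> nat) : {homo sigma : i j / (i < j)%N} ->
  forall k, (k <= sigma k)%N.
Proof.
move=> s; elim=> // k IH; exact: leq_ltn_trans IH (s _ _ (ltnSn k)).
Qed.

Section construction_bounds.
Context {R : realType} {n : nat}.
Notation Rn := 'rV[R]_n.

Lemma enorm_cvg0 (x : nat -> Rn) (x0 : Rn) : x k @[k --> \oo] --> x0 ->
  enorm (x k - x0) @[k --> \oo] --> (0 : R).
Proof.
move=> xx0; have c : edot (x k - x0) (x k - x0) @[k --> \oo] --> edot (x0 - x0) (x0 - x0).
  have sc := smooth_continuous (smooth_edot x0).
  exact: (cvg_comp _ _ xx0 (sc x0)).
rewrite subrr edot0l in c.
by apply: (cvg_of_sqr_le (K := 1) _ c) => j; rewrite subr0 mulr1 enorm_sqr.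
Qed.

Lemma R_seq_gt (rad : R) (r_ : nat -> R) (u_ : nat -> Rn -> R) k : r_ k < R_seq rad r_ u_ k.
Proof. by rewrite /R_seq -addrA ltrDl ltr_pwDl ?powR_ge0// invr_gt0 ltr0n. Qed.

(** This is what the summand (int u^2)^(1/4) of the radius is for: the error
    term u grad phi of the cutoff is at most of the order of the square root of
    int u^2 divided by R_k - r_k, that is of R_k - r_k. *)
Lemma R_seq_pow4 (rad : R) (r_ : nat -> R) (u_ : nat -> Rn -> R) k :
  ip (eball 0 (2 * rad)) (u_ k) (u_ k) <= (R_seq rad r_ u_ k - r_ k) ^+ 4.
Proof.
set J := ip _ _ _; have J0 : 0 <= J by exact: ip_ge0.
have -> : R_seq rad r_ u_ k - r_ k = k.+1%:R^-1 + J `^ 4^-1.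
  by rewrite /R_seq addrAC [r_ k + _]addrC addrK.
rewrite -[leLHS]powRr1// -{1}(@mulVf R 4)// powRrM powR_mulrn ?powR_ge0//.
rewrite ler_pXn2r ?nnegrE ?addr_ge0 ?powR_ge0 ?invr_ge0//.
by rewrite lerDr invr_ge0.
Qed.

(** Otherwise x0 would be a point of the ball. Applied to a boundary point x0
    that is the limit of the centres, this forces the radii to tend to 0. *)
Lemma eball_radius_le (U0 : set Rn) (x x0 : Rn) (t : R) : ~ U0 x0 ->
  compactly_contained (eball x t) U0 -> t <= enorm (x - x0).
Proof.
move=> nU [_ sub]; rewrite leNgt; apply/negP => h; apply: nU.
by apply: sub; apply: subset_closure; rewrite /eball/= enormB.
Qed.

End construction_bounds.

Theorem corollary3p11 (R : realType) (n : nat) (Omega U0 : set 'rV[R]_n)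
    (x0 : 'rV[R]_n) (rad : R) (r_ : nat -> R) (u_ : nat -> 'rV[R]_n -> R)
    (x_ : nat -> 'rV[R]_n)
    (n_ge2 : (2 <= n)%N)
    (Omega_open : open Omega) (Omega_bounded : bounded_set Omega)
    (U0_open : open U0) (U0_Omega : compactly_contained U0 Omega)
    (x0_boundary : boundary U0 x0)
    (rad_gt0 : 0 < rad)
    (rad_Omega : compactly_contained (eball x0 (2 * rad)) Omega)
    (r_bounds : forall k, 0 < r_ k < rad)
    (r_cvg0 : r_ k @[k --> \oo] --> (0 : R))
    (u_solution : forall k,
      poisson_solution (eball 0 (2 * rad)) (g_seq rad r_ k) (u_ k))
    (x_U0 : forall k, U0 (x_ k))
    (x_cvg : x_ k @[k --> \oo] --> x0)
    (x_balls : \forall k \near \oo,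
      compactly_contained (eball (x_ k) (R_seq rad r_ u_ k)) U0) :
  forall sigma : nat -> nat, {homo sigma : i j / (i < j)%N} ->
  exists U : set 'rV[R]_n,
    [/\ open U, U `<=` Omega,
        nu' (f_seq rad r_ x_) sigma U <> nu'' (f_seq rad r_ x_) sigma U &
        ~ Gamma_converges U
            (fun k v => energy (f_seq rad r_ x_ (sigma k)) v U)].
Proof.
move=> sigma sigma_inc.
have n0 : (0 < n)%N by exact: leq_trans n_ge2.
have sigma_ge := increasing_ge sigma_inc.
have r0 k : 0 < r_ k by have /andP[] := r_bounds k.
have nU0 : ~ U0 x0 by move=> Ux0; apply: x0_boundary.2; exact: open_nbhs_nbhs.
pose C : R := cutoff_cst.
have C0 : 0 < C by rewrite /C /cutoff_cst mulr_gt0// exprn_gt0// expR_gt0.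
(* when R_k < delta, the error term of the competitor is at most
   (4 C delta)^2 = (4/10)^2, which is less than 1/6 *)
pose delta := (10 * C)^-1.
have delta0 : 0 < delta by rewrite invr_gt0 mulr_gt0.
pose Rk := R_seq rad r_ u_.
pose d k := enorm (x_ k - x0).
have d_cvg0 := enorm_cvg0 x_cvg.
have [N _ HN] : \forall k \near \oo,
    compactly_contained (eball (x_ k) (Rk k)) U0 /\ d k < 2 * rad /\ d k < delta.
  have d_lt (e : R) : 0 < e -> \forall k \near \oo, d k < e.
    move=> e0; have /cvgr0_norm_lt/(_ _ e0) := d_cvg0; apply: filterS => k /=.
    by rewrite ger0_norm ?enorm_ge0.
  exact: filterI x_balls (filterI (d_lt _ (mulr_gt0 (ltr0n _ 2) rad_gt0)) (d_lt _ delta0)).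
(* rho is the radius of the balls that make up U, rho' that of the supports of
   the competitors; both leave a gap to r_k comparable with R_k - r_k *)
pose rho k := (r_ k + Rk k) / 2.
pose rho' k := (r_ k + rho k) / 2.
have rR k : r_ k < Rk k by exact: R_seq_gt.
have r_rho' k : r_ k < rho' k by have := rR k; rewrite /rho' /rho; lra.
have rho'_rho k : rho' k < rho k by have := rR k; rewrite /rho' /rho; lra.
have rho_R k : rho k < Rk k by have := rR k; rewrite /rho' /rho; lra.
have r_rho k : r_ k < rho k := lt_trans (r_rho' k) (rho'_rho k).
have R_d k : (N <= k)%N -> Rk k <= d k.
  by move=> /HN[cc _]; exact: eball_radius_le cc.
have [m [mN m_inc disj]] : exists m : nat -> nat,
  [/\ forall j, (N <= m j)%N, forall i j, (i < j)%N -> (m i < m j)%N &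
      forall i j y, (i < j)%N -> enorm (y - x_ (sigma (m i))) < rho (sigma (m i)) ->
        enorm (y - x_ (sigma (m j))) < rho (sigma (m j)) -> False].
  apply: (@disjoint_subsequence _ _ (x_ \o sigma) x0 (rho \o sigma) N).
  - apply/cvgr0Pnorm_lt => e e0; have /cvgr0_norm_lt/(_ _ e0)[M _ HM] := d_cvg0.
    by exists M => // k /= Mk; apply: HM; exact: leq_trans Mk (sigma_ge k).
  - by move=> k _; apply: ltW; exact: lt_trans (r0 _) (r_rho _).
  - move=> k Nk; apply: lt_le_trans (rho_R _) (R_d _ _).
    exact: leq_trans Nk (sigma_ge k).
have m_ge j : (j <= m j)%N by apply: increasing_ge; exact: m_inc.
have disj' i j y : i != j -> enorm (y - x_ (sigma (m i))) < rho (sigma (m i)) ->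
    enorm (y - x_ (sigma (m j))) < rho (sigma (m j)) -> False.
  by rewrite neq_ltn => /orP[ij yi yj|ij yi yj]; [exact: disj ij yi yj|exact: disj ij yj yi].
pose ball_ k := eball (x_ (sigma k)) (rho (sigma k)).
pose U := \bigcup_(j in [set: nat]) ball_ (m j.*2).
have oU : open U by apply: bigcup_open => j _; exact: eball_open.
have mU : measurable U := open_measurable_rV oU.
have UOmega : U `<=` Omega.
  move=> y [j _ yj]; apply: U0_Omega.2; apply: subset_closure.
  have [[_ cc] _] := HN _ (leq_trans (mN j.*2) (sigma_ge _)).
  by apply: cc; apply: subset_closure; exact: lt_trans yj (rho_R _).
exists U.
pose f_ := f_seq rad r_ x_.
pose E k := exists j, k = m j.*2.
(* a function and its gradient: the competitor if the rank k is chosen for U,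
   and 0 otherwise *)
have PX k : exists VG : ('rV[R]_n -> R) * ('rV[R]_n -> 'rV[R]_n),
   [/\ H10_gradient U VG.1 VG.2, vip U VG.2 VG.2 <= 7 / 2,
       E k -> (forall y, ~ ball_ k y -> VG.2 y = 0) /\
          \int[lebesgue_rV R n]_(y in U) (f_ (sigma k) y * VG.1 y) = 2 &
       ~ E k -> forall y, VG.2 y = 0].
  have [Ek|nEk] := pselect (E k); last first.
    exists (fun=> 0, fun=> 0); split=> //=; first exact: H10_gradient0.
    rewrite /vip; under eq_Rintegral do rewrite edot0l.
    by rewrite /Rintegral integral0 divr_ge0.
  pose K := sigma k.
  have NK : (N <= K)%N by rewrite /K; case: Ek => j ->; exact: leq_trans (mN _) (sigma_ge _).
  have [_ [d2 dd]] := HN _ NK.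
  have rho's : rho' K < 2 * rad.
    exact: lt_trans (rho'_rho K) (lt_trans (rho_R K) (le_lt_trans (R_d _ NK) d2)).
  have KU : [set y | enorm (y - x_ K) <= rho' K] `<=` U.
    move=> y /= yK; have [j kj] := Ek; exists j => //; rewrite /ball_ -kj.
    exact: le_lt_trans yK (rho'_rho K).
  have [v [G [vG Gout Gle fv]]] :=
    competitor n0 (r0 K) (r_rho' K) rho's oU KU (erefl _) (u_solution K).
  exists (v, G); split=> //=; last first.
    move=> _; split=> // y yb; apply: Gout.
    by apply: lt_le_trans (rho'_rho K) _; rewrite leNgt; apply/negP.
  apply: le_trans Gle _.
  pose eps := Rk K - r_ K.
  have eps0 : 0 < eps by rewrite subr_gt0.
  have -> : rho' K - r_ K = eps / 4 by rewrite /rho' /rho /eps; field.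
  have I4 : ip (eball 0 (2 * rad)) (u_ K) (u_ K) <= eps ^+ 4 by exact: R_seq_pow4.
  have epsd : eps <= delta.
    by apply: ltW; apply: le_lt_trans dd; apply: le_trans (R_d _ NK); rewrite gerBl ltW.
  have h : (C / (eps / 4)) ^+ 2 * ip (eball 0 (2 * rad)) (u_ K) (u_ K) <= (4 / 10) ^+ 2.
    apply: (@le_trans _ _ ((C / (eps / 4)) ^+ 2 * eps ^+ 4)).
      by apply: ler_wpM2l => //; exact: sqr_ge0.
    have -> : (C / (eps / 4)) ^+ 2 * eps ^+ 4 = (4 * C * eps) ^+ 2.
      by field; rewrite gt_eqF.
    have c4 : 0 <= 4 * C by rewrite mulr_ge0// ltW.
    rewrite ler_pXn2r ?nnegrE ?divr_ge0//; last by rewrite mulr_ge0// ltW.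
    apply: le_trans (ler_wpM2l c4 epsd) _.
    by rewrite /delta le_eqVlt; apply/orP; left; apply/eqP; field; rewrite gt_eqF.
  by move: h; rewrite -/C expr2; lra.
pose VG k := projT1 (cid (PX k)).
have P k := projT2 (cid (PX k)); rewrite -/(VG _) in P.
pose v_ k := (VG k).1.
have vH k : H10 U (v_ k) by have [? _ _ _] := P k; exists (VG k).2.
have vnull : weakly_null U v_.
  apply: (orthogonal_weakly_null mU (M := 7 / 2)) => // [i j ij|k]; last first.
    by have [vG h _ _] := P k; rewrite (dirichletE mU vG vG).
  have [viG _ Ei nEi] := P i; have [vjG _ Ej nEj] := P j.
  rewrite (dirichletE mU viG vjG) /vip.
  suff z y : edot ((VG i).2 y) ((VG j).2 y) = 0.
    by under eq_Rintegral do rewrite z; rewrite /Rintegral integral0.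
  have [Eii|/nEi -> ] := pselect (E i); last by rewrite edot0l.
  have [Ejj|/nEj -> ] := pselect (E j); last by rewrite edotC edot0l.
  have [Gi _] := Ei Eii; have [Gj _] := Ej Ejj.
  have [yi|/Gi ->] := pselect (ball_ i y); last by rewrite edot0l.
  have [yj|/Gj ->] := pselect (ball_ j y); last by rewrite edotC edot0l.
  move: Eii Ejj ij yi yj => [a ->] [b ->] ab yi yj; exfalso.
  have ab2 : a.*2 != b.*2 by apply: contraNneq ab => ->.
  exact: disj' ab2 yi yj.
have low K : exists2 k, (K <= k)%N & energy (f_ (sigma k)) (v_ k) U <= - 4^-1.
  exists (m K.*2).
    by apply: leq_trans (m_ge _); rewrite -addnn leq_addr.
  have [vG h /(_ (ex_intro _ K erefl))[_ fv] _] := P (m K.*2).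
  rewrite /energy fv -[X in 2^-1 * X]/(dirichlet U (v_ (m K.*2)) (v_ (m K.*2))).
  rewrite (dirichletE mU vG vG); lra.
have high K : exists2 k, (K <= k)%N & forall w, H10 U w -> 0 <= energy (f_ (sigma k)) w U.
  exists (m K.*2.+1).
    by apply: leq_trans (m_ge _); rewrite -addnn (leq_trans (leq_addr K K)).
  move=> w wU; rewrite /energy.
  (* the force is carried by a ball of odd rank, which does not meet U *)
  rewrite (_ : \int[_]_(_ in _) (f_ _ _ * _) = 0) ?subr0.
    by rewrite mulr_ge0 ?invr_ge0//; exact: dirichlet_ge0.
  rewrite (@eq_Rintegral _ _ _ _ _ (fun=> 0)); first by rewrite /Rintegral integral0.
  move=> y; rewrite inE => -[j _ yj]; rewrite /f_ /f_seq /g_seq indicE memNset ?mulr0 ?mul0r//.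
  rewrite /eball/= subr0 => yr.
  have jK : j.*2 != K.*2.+1 by apply/eqP => /(congr1 odd); rewrite /= !odd_double.
  exact: disj' jK yj (lt_trans yr (r_rho _)).
have q0 : 0 < 4^-1 :> R by rewrite invr_gt0.
have [nuN GN] := nonconvergence mU q0 vnull low high.
by split.
Qed.
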